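(* Let $Z=\{Z(t)\}_{t\ge0}$ be a real-valued Lévy process with Lévy exponent $\psi(\lambda)=\log\mathbb{E}[e^{\lambda Z(1)}]$ and strictly positive diffusion coefficient. Let $\varphi(\lambda)=\mathbb{E}[e^{\lambda Z(1)}]$, $\Lambda=\{\lambda\in\mathbb{R}:\varphi(\lambda)<+\infty\}$ and $\Lambda_+=(0,+\infty)\cap\operatorname{int}(\Lambda)$. Assume that $\Lambda_+$ is non-empty, that $\varphi$ is at least twice differentiable in $\Lambda_+$, and that there exists $\lambda^*\in\Lambda_+$ with $\psi(\lambda^* )=0$. Let $B$ belong to the class $L(\lambda)$ for some $\lambda\in\Lambda_+$. Then for every integer $N\ge2$, $$\lim_{x\to+\infty}\frac{\mathbb{P}\left(\tau^{(N)}(x)\le \frac{B(x)}{N}\right)}{\mathbb{P}\left(\tau(x)\le B(x)\right)}=\begin{cases} N, & \text{if } N\psi'(\lambda)<\psi'(\lambda^* ),\\ 0, & \text{if } N\psi'(\lambda)>\psi'(\lambda^* ).\end{cases}$$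
   Context: Lévy processes start at $Z(0)=0$ and are taken càdlàg. The Lévy exponent has the form $\psi(\lambda)=-\mu\lambda+\frac{(\sigma\lambda)^2}{2}+\int_{-\infty}^{+\infty}(e^{\lambda y}-1-\lambda y\mathbf{1}(|y|\le1))\,\Pi(dy)$ with $\mu\in\mathbb{R}$, diffusion coefficient $\sigma\in(0,+\infty)$, and Lévy measure $\Pi$ on $\mathbb{R}\setminus\{0\}$ satisfying $\int(1\wedge y^2)\,\Pi(dy)<+\infty$. $\tau(x)=\inf\{t\ge 0: Z(t)\ge x\}$. $\tau^{(N)}(x)=\min\{\tau_1(x),\dots,\tau_N(x)\}$, where $\tau_1(x),\dots,\tau_N(x)$ are independent random times each distributed as $\tau(x)$. For $\lambda\in\Lambda_+$, $L(\lambda)$ is the set of functions $f:\mathbb{R}\to\mathbb{R}$ such that $x=\psi'(\lambda)\,f(x)+o\left(\sqrt{f(x)}\right)$ as $x\to+\infty$. *)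

(* Defs.v *)
From HB Require Import structures.
From mathcomp Require Export all_boot all_order all_algebra.
From mathcomp Require Export all_classical all_reals all_analysis.
(* carries the measurable structure of \bar R *)
From mathcomp Require Export measurable_realfun.

Set Implicit Arguments.
Unset Strict Implicit.
Unset Printing Implicit Defensive.

Import Order.TTheory GRing.Theory Num.Theory.
Import numFieldTopology.Exports numFieldNormedType.Exports.

Local Open Scope classical_set_scope.
Local Open Scope ring_scope.

(* The A i range over all measurable sets, setT included, so the product rule
   for every subfamily is covered. *)
Definition mutually_independent (d d' : measure_display)
    (Omega : measurableType d) (E : measurableType d') (R : realType)
    (P : probability Omega R) (n : nat) (X : 'I_n -> Omega -> E) : Prop :=
  forall A : 'I_n -> set E, (forall i, measurable (A i)) ->
    P [set w | forall i, A i (X i w)] = (\prod_(i < n) P (X i @^-1` A i))%E.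

(* Time is indexed by R; the values of Z at negative times play no role. *)
Record levy_process (d : measure_display) (Omega : measurableType d)
    (R : realType) (P : probability Omega R) (Z : R -> {RV P >-> R}) : Prop :=
  LevyProcess {
    levy_start : forall w, Z 0 w = 0 ;
    levy_independent : forall (n : nat) (t : nat -> R),
      0 <= t 0%N -> nondecreasing_seq t ->
      mutually_independent P (fun (i : 'I_n) w => Z (t i.+1) w - Z (t i) w) ;
    levy_stationary : forall s t : R, 0 <= s -> 0 <= t ->
      forall A : set R, measurable A ->
      P ((fun w => Z (s + t) w - Z s w) @^-1` A) = P (Z t @^-1` A) ;
    levy_right_continuous : forall w (t : R), 0 <= t ->
      Z s w @[s --> t^'+] --> Z t w ;
    levy_left_limits : forall w (t : R), 0 < t -> cvg (Z s w @[s --> t^'-])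
  }.

Definition phi (d : measure_display) (Omega : measurableType d) (R : realType)
    (P : probability Omega R) (Z : R -> {RV P >-> R}) (l : R) : \bar R :=
  mmt_gen_fun P (Z 1) l.

(* lne is the extended logarithm: psi l = +oo exactly when phi l = +oo. *)
Definition psi (d : measure_display) (Omega : measurableType d) (R : realType)
    (P : probability Omega R) (Z : R -> {RV P >-> R}) (l : R) : \bar R :=
  lne (phi Z l).

Definition Lambda (d : measure_display) (Omega : measurableType d)
    (R : realType) (P : probability Omega R) (Z : R -> {RV P >-> R}) : set R :=
  [set l | (phi Z l < +oo)%E].

Definition Lambda_plus (d : measure_display) (Omega : measurableType d)
    (R : realType) (P : probability Omega R) (Z : R -> {RV P >-> R}) : set R :=
  [set l | 0 < l] `&` (Lambda Z)°.

(* phi and psi are finite on Lambda, hence near every point of Lambda_plus,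
   so fine does not alter their derivatives there. *)
Definition rphi (d : measure_display) (Omega : measurableType d)
    (R : realType) (P : probability Omega R) (Z : R -> {RV P >-> R}) (l : R) :
  R := fine (phi Z l).

Definition dpsi (d : measure_display) (Omega : measurableType d)
    (R : realType) (P : probability Omega R) (Z : R -> {RV P >-> R}) (l : R) :
  R := (fun s : R => fine (psi Z s))^`()%classic l.

(* A measure on R without mass at 0 encodes a measure on R minus {0}. *)
Definition levy_measure (R : realType) (Pi : {measure set R -> \bar R}) : Prop :=
  Pi [set 0] = 0%E /\ (\int[Pi]_y (Num.min 1 (y ^+ 2))%:E < +oo)%E.

(* The integrand has integrable negative part whenever Pi is a Levy measure, so
   the extended-real integral is meaningful, and the equation forces it to be
   finite for l in Lambda. *)
Definition levy_khintchine (d : measure_display) (Omega : measurableType d)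
    (R : realType) (P : probability Omega R) (Z : R -> {RV P >-> R})
    (mu sigma : R) (Pi : {measure set R -> \bar R}) : Prop :=
  forall l : R, Lambda Z l ->
    (psi Z l = (- mu * l + (sigma * l) ^+ 2 / 2)%:E +
      \int[Pi]_y (expR (l * y) - 1 - l * y * (`|y| <= 1)%R%:R)%:E)%E.

(* +oo when the level x is never reached *)
Definition tau (d : measure_display) (Omega : measurableType d) (R : realType)
    (P : probability Omega R) (Z : R -> {RV P >-> R}) (x : R) (w : Omega) :
  \bar R := ereal_inf [set t%:E | t in [set t : R | 0 <= t /\ x <= Z t w]].

Definition tau_min (Omega : Type) (R : realType) (N : nat)
    (T : 'I_N -> Omega -> \bar R) (w : Omega) : \bar R :=
  (\big[mine/+oo]_(i < N) T i w)%E.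

(* lets the little-o notation below be used at +oo *)
Canonical pinfty_filter_on (R : numFieldType) :=
  FilterType (pinfty_nbhs R) (@filter_filter _ _ proper_pinfty_nbhs).

(* Num.sqrt is 0 on negative reals, so nonnegativity of f near +oo, implicit in
   the term sqrt (f x), has to be required. *)
Definition class_L (d : measure_display) (Omega : measurableType d)
    (R : realType) (P : probability Omega R) (Z : R -> {RV P >-> R}) (l : R)
    (f : R -> R) : Prop :=
  (\forall x \near +oo, 0 <= f x) /\
  (fun x : R => x - dpsi Z l * f x) =o_ (+oo_R) (fun x : R => Num.sqrt (f x)).

(* Main.v *)
(* Only exponential rates matter.  With psi(lambda) = log E exp(lambda Z(1)):
   - Doob's inequality for the martingale exp(theta Z(t) - t psi(theta)), first on
     dyadic grids and then by right continuity, gives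
       P(tau(x) <= T) <= C exp(psi(theta) T - theta x)          if psi(theta) >= 0,
       P(T1 < tau(x) <= T2) <= C exp(psi(theta) T1 - theta x)   if psi(theta) <= 0;
   - exponential tilting of the walk Z(n) at theta gives, for
     0 < a < psi'(theta) < b and psi(theta) >= 0,
       P(tau(x) <= x / a + 1) >= c exp(- (theta b - psi(theta)) x / a);
   - sigma > 0 makes psi strictly convex, so psi'(lstar) > 0 and psi' is
     strictly increasing.
   If p and q are the probabilities of {tau(x) <= B(x) / N} and {tau(x) <= B(x)},
   the ratio is (1 - (1 - p)^N) / q.  When N psi'(lambda) < psi'(lstar), both
   times exceed x / psi'(lstar), the typical passage time given that x is
   reached; then q - p is exponentially smaller than p (theta slightly below
   lstar), so p / q tends to 1 while p tends to 0.  When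
   N psi'(lambda) > psi'(lstar), B(x) / N is too short: p decays strictly
   faster than q, by comparing the rates at theta close to
   max(lambda, lstar). *)
From HB Require Import structures.
From mathcomp Require Import ring lra.
Require Import Defs.

Set Implicit Arguments.
Unset Strict Implicit.
Unset Printing Implicit Defensive.

Import Order.TTheory GRing.Theory Num.Theory.
Import numFieldTopology.Exports numFieldNormedType.Exports.

Local Open Scope classical_set_scope.
Local Open Scope ring_scope.

(** * Independence and expectations *)

(** The product rule on rectangles identifies the joint law of [(U, V)] with the product of the
    marginal laws; Tonelli then splits the integral. *)
Lemma ge0_expectation_indep_mul d1 d2 d3 (Omega : measurableType d1)
    (T1 : measurableType d2) (T2 : measurableType d3) (R : realType)
    (P : probability Omega R) (U : {mfun Omega >-> T1}) (V : {mfun Omega >-> T2})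
    (f : T1 -> \bar R) (g : T2 -> \bar R) :
  (forall A B, measurable A -> measurable B ->
    P (U @^-1` A `&` V @^-1` B) = (P (U @^-1` A) * P (V @^-1` B))%E) ->
  measurable_fun setT f -> measurable_fun setT g ->
  (forall x, 0 <= f x)%E -> (forall x, 0 <= g x)%E ->
  (\int[P]_w (f (U w) * g (V w)) =
   (\int[P]_w f (U w)) * \int[P]_w g (V w))%E.
Proof.
move=> indep mf mg f0 g0.
pose mUV := (distribution P U \x distribution P V)%E.
pose W := fun w => (U w, V w).
have mW : measurable_fun setT W by exact/measurable_fun_pair.
pose W' : {mfun Omega >-> (T1 * T2)%type} :=
  HB.pack W (isMeasurableFun.Build _ _ _ _ W mW).
have mfst : measurable_fun setT (fun z : T1 * T2 => f z.1).
  exact: measurableT_comp.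
have msnd : measurable_fun setT (fun z : T1 * T2 => g z.2).
  exact: measurableT_comp.
have mfg : measurable_fun setT (fun z : T1 * T2 => f z.1 * g z.2)%E.
  exact: emeasurable_funM.
have fg0 z : (0 <= f z.1 * g z.2)%E by exact: mule_ge0.
transitivity (\int[distribution P W']_z (f z.1 * g z.2))%E.
  by rewrite ge0_integral_pushforward.
transitivity (\int[mUV]_z (f z.1 * g z.2))%E.
  apply: eq_measure_integral => A mA _.
  exact/esym/product_measure_unique.
rewrite fubini_tonelli1// /fubini_F/=.
under eq_integral do rewrite ge0_integralZl//.
rewrite ge0_integralZr//; last exact: integral_ge0.
by rewrite !ge0_integral_pushforward.
Qed.


Lemma indep_g_sigma_algebra d1 d2 (Omega : measurableType d1)
    (T : measurableType d2) (R : realType) (P : probability Omega R)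
    (V : {mfun Omega >-> T}) (G : set (set Omega)) :
  G `<=` measurable -> G setT -> setI_closed G ->
  (forall A B, G A -> measurable B ->
    P (A `&` V @^-1` B) = (P A * P (V @^-1` B))%E) ->
  forall A B, <<s G >> A -> measurable B ->
    P (A `&` V @^-1` B) = (P A * P (V @^-1` B))%E.
Proof.
move=> Gm GT GI indep A B sA mB.
have mVB : measurable (V @^-1` B) by exact: measurable_funPTI.
have c0 : 0 <= fine (P (V @^-1` B)) by exact: fine_ge0.
have EB : P (V @^-1` B) = (fine (P (V @^-1` B)))%:E.
  by rewrite fineK//; exact: fin_num_measure.
pose m1 := mrestr P mVB.
pose m2 := mscale (NngNum c0) P.
have -> : P (A `&` V @^-1` B) = m1 A by [].
have -> : (P A * P (V @^-1` B) = m2 A)%E by rewrite /m2/= /mscale/= muleC -EB.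
apply: (g_sigma_algebra_measure_unique G Gm (fun=> setT)) => //.
- by apply/seteqP; split => // x _; exists 0%N.
- move=> C GC; rewrite /m1/= /mrestr indep// /m2/= /mscale/= -EB muleC//.
- move=> _; rewrite /m1/= /mrestr (le_lt_trans _ (ltry 1))//.
  by apply: probability_le1; rewrite setTI.
Qed.

(** The identity of [Omega], with target sigma-algebra [<<s G >>], is a random variable independent
    of [V], and the indicator of [A] is a function of it. So an event of the past factors out of the
    expectation of a later increment. *)
Lemma ge0_integral_indep d1 d2 (Omega : measurableType d1)
    (T : measurableType d2) (R : realType) (P : probability Omega R)
    (V : {mfun Omega >-> T}) (G : set (set Omega)) (g : T -> \bar R) :
  G `<=` measurable -> G setT -> setI_closed G ->
  (forall A B, G A -> measurable B ->
    P (A `&` V @^-1` B) = (P A * P (V @^-1` B))%E) ->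
  measurable_fun setT g -> (forall x, 0 <= g x)%E ->
  forall A, <<s G >> A ->
  (\int[P]_(w in A) g (V w) = P A * \int[P]_w g (V w))%E.
Proof.
move=> Gm GT GI indep mg g0 A sA.
have sGm : <<s G >> `<=` measurable.
  exact: smallest_sub (sigma_algebra_measurable Omega) Gm.
pose gT : measurableType _ := g_sigma_algebraType G.
pose idG : Omega -> gT := id.
have midG : measurable_fun setT idG.
  by move=> _ B mB; rewrite setTI; exact: sGm.
pose U : {mfun Omega >-> gT} :=
  HB.pack idG (isMeasurableFun.Build _ _ _ _ idG midG).
have mA : measurable (A : set gT) by [].
have -> : P A = (\int[P]_w (\1_A w)%:E)%E.
  by rewrite integral_indic ?setIT//; exact: sGm.
rewrite integral_mkcond.
transitivity (\int[P]_w ((\1_A w)%:E * g (V w)))%E.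
  apply: eq_integral => w _.
  by rewrite patchE indicE; case: ifPn => _; rewrite ?mul1e ?mul0e.
apply: (@ge0_expectation_indep_mul _ _ _ Omega gT T R P U V
  (EFin \o (\1_A : gT -> R)) g) => //=.
- by move=> B C sB mC; exact: (indep_g_sigma_algebra Gm GT GI indep).
- by apply/measurable_EFinP; exact: measurable_indic.
Qed.

(** * Exponential moments of the process as a function of time *)

Section moment_generating_function.
Context d (Omega : measurableType d) (R : realType) (P : probability Omega R).
Variables (Z : R -> {RV P >-> R}) (HZ : levy_process Z).
Implicit Types s t h l x : R.

Lemma mmt_gen_funE (X : Omega -> R) l :
  mmt_gen_fun P X l = (\int[P]_w (expR (l * X w))%:E)%E.
Proof.
by rewrite /mmt_gen_fun unlock; apply: eq_integral => w _ /=; rewrite mulrC.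
Qed.

Lemma measurable_expR_scale l : measurable_fun setT (fun x : R => (expR (l * x))%:E).
Proof.
by apply/measurable_EFinP; apply: measurableT_comp.
Qed.
Hint Resolve measurable_expR_scale : core.

Lemma expR_scale_ge0 l x : (0 <= (expR (l * x))%:E)%E.
Proof. by rewrite lee_fin expR_ge0. Qed.
Hint Resolve expR_scale_ge0 : core.

Lemma mmt_gen_fun_increment s t l : 0 <= s -> 0 <= t ->
  mmt_gen_fun P (fun w => Z (s + t) w - Z s w) l = mmt_gen_fun P (Z t) l.
Proof.
move=> s0 t0; rewrite !mmt_gen_funE.
pose V : {mfun Omega >-> R} := (Z (s + t) \- Z s)%R.
transitivity (\int[distribution P V]_y (expR (l * y))%:E)%E.
  by rewrite ge0_integral_pushforward.
transitivity (\int[distribution P (Z t)]_y (expR (l * y))%:E)%E.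
  by apply: eq_measure_integral => A mA _; exact: (levy_stationary HZ s0 t0 mA).
by rewrite ge0_integral_pushforward.
Qed.

Lemma mmt_gen_funD s t l : 0 <= s -> 0 <= t ->
  (mmt_gen_fun P (Z (s + t)) l =
   mmt_gen_fun P (Z s) l * mmt_gen_fun P (Z t) l)%E.
Proof.
move=> s0 t0; rewrite -(mmt_gen_fun_increment l s0 t0) !mmt_gen_funE.
pose V : {mfun Omega >-> R} := (Z (s + t) \- Z s)%R.
rewrite -(@ge0_expectation_indep_mul _ _ _ Omega R R R P (Z s) V
  (fun x => (expR (l * x))%:E) (fun x => (expR (l * x))%:E)) //.
  apply: eq_integral => w _; rewrite -EFinM -expRD -mulrDr /=.
  by congr (expR (l * _))%:E; rewrite addrCA subrr addr0.
move=> A B mA mB.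
(* On the grid [0, s, s + t], the value [Z s] is itself the first increment, because [Z 0 = 0]. *)
pose tt (i : nat) : R := if i is i'.+1 then (if i' is _.+1 then s + t else s) else 0.
have ndt : nondecreasing_seq tt.
  apply/nondecreasing_seqP => -[|[|n]] //=; by rewrite ?lerDl.
have := @levy_independent _ _ _ _ _ HZ 2%N tt (lexx 0) ndt.
pose AB (i : 'I_2) := if i == ord0 then A else B.
have mAB i : measurable (AB i) by rewrite /AB; case: ifP.
move=> /(_ AB mAB); rewrite !big_ord_recl big_ord0 mule1 /AB /=.
have -> : (fun w => Z s w - Z 0 w) @^-1` A = Z s @^-1` A.
  by apply/funext => w /=; rewrite (levy_start HZ) subr0.
move=> <-; congr (P _); apply/seteqP; split => w /=.
  move=> [Aw Bw] [[|[|//]] ?] //=.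
  by rewrite (levy_start HZ) subr0.
move=> H; split; first by have := H ord0; rewrite /= (levy_start HZ) subr0.
exact: (H (lift ord0 ord0)).
Qed.

Lemma mmt_gen_fun_mulrn h l k : 0 <= h ->
  (mmt_gen_fun P (Z (k%:R * h)) l = mmt_gen_fun P (Z h) l ^+ k)%E.
Proof.
move=> h0; elim: k => [|k IH].
  rewrite mul0r mmt_gen_funE expe0; under eq_integral.
    move=> w _; rewrite (levy_start HZ) mulr0 expR0; over.
  by rewrite integral_cst// mul1e; exact: probability_setT.
rewrite -natr1 mulrDl mul1r mmt_gen_funD// ?mulr_ge0// IH expeS muleC//.
Qed.

End moment_generating_function.

(** * Maximal inequality *)

Section maximal_inequality.
Context d (Omega : measurableType d) (R : realType) (P : probability Omega R).
Variables (Z : R -> {RV P >-> R}) (HZ : levy_process Z).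
Implicit Types s t h l x : R.

(** A pi-system generating the past of the walk [Z (i h)] up to time [k h]. It constrains increments
    rather than values, since independence is stated for increments. *)
Definition increment_cylinder h k : set (set Omega) :=
  [set A | exists2 C : nat -> set R, (forall i, measurable (C i)) &
    A = [set w | forall i, (i < k)%N ->
          C i (Z (i.+1%:R * h) w - Z (i%:R * h) w)] ].

Lemma increment_cylinder_measurable h k : increment_cylinder h k `<=` measurable.
Proof.
move=> _ [C mC ->].
rewrite (_ : [set w | _] = \bigcap_(i in [set i | (i < k)%N])
  ((Z (i.+1%:R * h) \- Z (i%:R * h)) @^-1` C i)).
  by apply: bigcap_measurableType => i _; exact: measurable_funPTI.
by apply/seteqP; split => w.
Qed.

Lemma increment_cylinderT h k : increment_cylinder h k setT.
Proof. by exists (fun=> setT) => //; apply/seteqP; split. Qed.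

Lemma increment_cylinderI h k : setI_closed (increment_cylinder h k).
Proof.
move=> _ _ [C mC ->] [D mD ->]; exists (fun i => C i `&` D i).
  by move=> i; exact: measurableI.
apply/seteqP; split => w /=.
  by move=> [Cw Dw] i ik; split; [exact: Cw|exact: Dw].
by move=> CDw; split => i ik; have [] := CDw i ik.
Qed.

Lemma increment_cylinder_indep h k t : 0 <= h -> k%:R * h <= t ->
  forall A B, increment_cylinder h k A -> measurable B ->
  P (A `&` (Z t \- Z (k%:R * h))%R @^-1` B) =
  (P A * P ((Z t \- Z (k%:R * h))%R @^-1` B))%E.
Proof.
move=> h0 kt A B [C mC ->] mB.
(* The grid is [0, h, ..., k h, t], constant afterwards to stay nondecreasing, so its increment
   number [k] is [Z t - Z (k h)]. *)
pose tt (i : nat) : R := if (i <= k)%N then i%:R * h else t.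
have ndt : nondecreasing_seq tt.
  apply/nondecreasing_seqP => n; rewrite /tt.
  have [nk|nk] := ltnP n k; first by rewrite ltnW// ler_wpM2r// ler_nat.
  by case: ifPn => // nk'; have /eqP -> : n == k by rewrite eqn_leq nk nk'.
have tt0 : 0 <= tt 0%N by rewrite /tt mul0r.
(* Proved for every [D], because [D = setT] also evaluates [P A] as the product over the first [k]
   increments. *)
have key D : measurable D ->
    P ([set w | forall i, (i < k)%N ->
          C i (Z (i.+1%:R * h) w - Z (i%:R * h) w)] `&`
       (Z t \- Z (k%:R * h))%R @^-1` D) =
    (\prod_(i < k) P [set w | C i (Z (i.+1%:R * h) w - Z (i%:R * h) w)]%R *
     P ((Z t \- Z (k%:R * h))%R @^-1` D))%E.
  move=> mD.
  pose CD (i : 'I_k.+1) := if (i < k)%N then C i else D.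
  have mCD i : measurable (CD i) by rewrite /CD; case: ifP.
  have := @levy_independent _ _ _ _ _ HZ k.+1 tt tt0 ndt CD mCD.
  rewrite big_ord_recr/=.
  under eq_bigr => i _.
    rewrite /CD/= ltn_ord /tt ltn_ord ltnW//.
    over.
  rewrite /CD /tt /= ltnn leqnn => <-; congr (P _).
  apply/seteqP; split => w /=.
    move=> [Cw Dw] [i ik1] /=; case: ifPn => ik; first by rewrite ltnW//; exact: Cw.
    have -> : i = k by apply/eqP; rewrite eqn_leq -ltnS ik1 leqNgt ik.
    by rewrite leqnn.
  move=> H; split.
    move=> i ik; have := H (Ordinal (leqW ik)).
    by rewrite /= ik ltnW.
  by have := H ord_max; rewrite /= ltnn leqnn.
rewrite key//; congr (_ * _)%E.
by have := key setT measurableT; rewrite preimage_setT setIT probability_setT mule1.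
Qed.

(** [Z (j h)] is the sum of its first [j] increments, each measurable for the generated
    sigma-algebra. *)
Lemma increment_cylinder_level h k j x : (j <= k)%N ->
  <<s increment_cylinder h k >> [set w | x <= Z (j%:R * h) w].
Proof.
move=> jk.
pose gT : measurableType _ := g_sigma_algebraType (increment_cylinder h k).
have mZ : measurable_fun setT (Z (j%:R * h) : gT -> R).
  elim: j jk => [_|j IH jk].
    rewrite mul0r (_ : (Z 0 : gT -> R) = cst 0)//.
    by apply/funext => w; rewrite (levy_start HZ).
  rewrite (_ : (Z _ : gT -> R) = (fun w => Z (j%:R * h) w +
      (Z (j.+1%:R * h) w - Z (j%:R * h) w))); last first.
    by apply/funext => w; rewrite addrCA subrr addr0.
  apply: measurable_funD; first by apply: IH; exact: ltnW.
  move=> _ B mB; rewrite setTI; apply: sub_sigma_algebra.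
  exists (fun i => if i == j then B else setT) => [i|]; first by case: ifP.
  apply/seteqP; split => w /=.
    by move=> Bw i ik; case: ifPn => // /eqP ->.
  by move=> /(_ _ jk); rewrite eqxx.
have := @measurable_fun_le _ gT R setT (cst x) _ measurableT (measurable_cst _) mZ.
by rewrite setTI.
Qed.

(** On [A], [Z (K h)] is at least [x] plus the increment after time [k h]; that increment is
    independent of [A] and has exponential moment [a ^+ (K - k)]. *)
Lemma expR_passage_le h l x k K a (A : set Omega) : 0 <= h -> 0 < l ->
  mmt_gen_fun P (Z h) l = a%:E -> (k <= K)%N ->
  <<s increment_cylinder h k >> A -> A `<=` [set w | x <= Z (k%:R * h) w] ->
  ((expR (l * x) * a ^+ (K - k))%:E * P A <=
   \int[P]_(w in A) (expR (l * Z (K%:R * h) w))%:E)%E.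
Proof.
move=> h0 l0 aE kK sA AZ.
have mA : measurable A.
  move: sA; apply: smallest_sub; first exact: sigma_algebra_measurable.
  exact: increment_cylinder_measurable.
pose V : {mfun Omega >-> R} := (Z (K%:R * h) \- Z (k%:R * h))%R.
have := @ge0_integral_indep _ _ Omega R R P V (increment_cylinder h k)
  (fun y => (expR (l * y))%:E) (@increment_cylinder_measurable h k)
  (@increment_cylinderT h k) (@increment_cylinderI h k).
have khK : k%:R * h <= K%:R * h by rewrite ler_wpM2r// ler_nat.
move=> /(_ (increment_cylinder_indep h0 khK) (measurable_expR_scale _)).
move=> /(_ (expR_scale_ge0 _) _ sA) intA.
have : (\int[P]_w (expR (l * V w))%:E = (a ^+ (K - k))%:E)%E.
  rewrite -mmt_gen_funE /=.
  have := mmt_gen_fun_increment HZ l (s := k%:R * h) (t := (K - k)%:R * h).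
  rewrite -mulrDl -natrD subnKC// => ->; rewrite ?mulr_ge0//.
  by rewrite (mmt_gen_fun_mulrn HZ)// aE EFin_expe.
move=> VE; rewrite VE in intA.
have -> : ((expR (l * x) * a ^+ (K - k))%:E * P A =
    (expR (l * x))%:E * \int[P]_(w in A) (expR (l * V w))%:E)%E.
  by rewrite intA EFinM -muleA [(_ * P A)%E in LHS]muleC.
rewrite -ge0_integralZl//.
- apply: ge0_le_integral => //.
  + apply: measurable_funTS; apply/measurable_EFinP.
    apply: measurable_funM => //; apply: measurableT_comp => //.
    exact: measurable_funM.
  + apply: measurable_funTS; apply/measurable_EFinP.
    by apply: measurableT_comp => //; exact: measurable_funM.
  + move=> w Aw; rewrite lee_fin -expRD ler_expR -mulrDr ler_pM2l//=.
    by rewrite -lerBrDr opprB addrCA subrr addr0; exact: AZ.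
- apply: measurable_funTS.
  by apply: measurableT_comp (measurable_expR_scale l) _.
Qed.

(** Doob's argument: split according to the first index at which the level is passed, apply
    [expR_passage_le] to each piece, and sum against the total moment [a ^+ K]. *)
Lemma discrete_maximal_inequality h l x k1 K a : 0 <= h -> 0 < l -> 0 < a ->
  mmt_gen_fun P (Z h) l = a%:E -> (k1 <= K)%N ->
  (P (\bigcup_(k in [set k | (k1 <= k <= K)%N]) [set w | (x <= Z (k%:R * h) w)%R])
   <= (expR (- (l * x)) * Num.max (a ^+ k1) (a ^+ K))%:E)%E.
Proof.
move=> h0 l0 a0 aE k1K.
(* With empty sets before [k1], [seqDU E k] is the event that [k] is the first index from [k1] on
   with the walk at or above [x]. *)
pose E k := if (k1 <= k)%N then [set w | (x <= Z (k%:R * h) w)%R] else set0.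
have sE k j : (k <= j)%N -> <<s increment_cylinder h j >> (E k).
  pose gT : measurableType _ := g_sigma_algebraType (increment_cylinder h j).
  move=> kj; rewrite /E; case: ifPn => _; first exact: increment_cylinder_level.
  exact: (@measurable0 _ gT).
have sA k : <<s increment_cylinder h k >> (seqDU E k).
  pose gT : measurableType _ := g_sigma_algebraType (increment_cylinder h k).
  apply: (@measurableD _ gT); first exact: sE.
  by apply: (@bigsetU_measurable _ gT) => i _; apply: sE; exact/ltnW.
have mA k : measurable (seqDU E k).
  have := sA k; apply: smallest_sub; first exact: sigma_algebra_measurable.
  exact: increment_cylinder_measurable.
set M := Num.max _ _.
have M0 : 0 < M by rewrite lt_max exprn_gt0.
(* [a ^+ k <= M] for [k1 <= k <= K], whether [a] is below or above 1, so [a ^+ K / M] bounds every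
   [a ^+ (K - k)] from below. *)
pose c := expR (l * x) * (a ^+ K / M).
have c0 : 0 < c by rewrite mulr_gt0 ?expR_gt0// divr_gt0// exprn_gt0.
have cA k : (k < K.+1)%N ->
    (c%:E * P (seqDU E k) <=
     \int[P]_(w in seqDU E k) (expR (l * Z (K%:R * h) w))%:E)%E.
  rewrite ltnS => kK; have [k1k|k1k] := leqP k1 k; last first.
    rewrite (_ : seqDU E k = set0) ?measure0 ?mule0 ?integral_set0//.
    by rewrite /seqDU /E leqNgt k1k/= set0D.
  have AE : seqDU E k `<=` [set w | x <= Z (k%:R * h) w].
    by apply: subset_trans (@subset_seqDU _ _ _) _; rewrite /E k1k.
  apply: le_trans (expR_passage_le h0 l0 aE kK (sA k) AE).
  apply: lee_wpmul2r => //; rewrite lee_fin ler_wpM2l ?expR_ge0//.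
  rewrite ler_pdivrMr// -[in leLHS](subnK kK) exprD ler_pM2l ?exprn_gt0//.
  rewrite /M le_max; have [a1|/ltW a1] := leP a 1.
    by rewrite ler_wiXn2l// ltW.
  by rewrite [X in _ || X]ler_weXn2l// orbT.
have -> : \bigcup_(k in [set k | (k1 <= k <= K)%N]) [set w | x <= Z (k%:R * h) w] =
    \big[setU/set0]_(k < K.+1) seqDU E k.
  rewrite -bigsetU_seqDU -bigcup_mkord; apply/seteqP; split => w [k /=].
    by move=> /andP[k1k kK] xw; exists k => //=; rewrite /E k1k.
  by rewrite ltnS /E => kK; case: ifPn => // k1k xw; exists k => //=; rewrite k1k.
have tA : trivIset setT (seqDU E) by exact: trivIset_seqDU.
have : (c%:E * P (\big[setU/set0]_(k < K.+1) seqDU E k) <= (a ^+ K)%:E)%E.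
  rewrite measure_bigsetU// ge0_sume_distrr//.
  apply: (@le_trans _ _ (\sum_(k < K.+1)
      \int[P]_(w in seqDU E k) (expR (l * Z (K%:R * h) w))%:E)%E).
    by apply: lee_sum => k _; exact: cA.
  rewrite EFin_expe -aE -(mmt_gen_fun_mulrn HZ)// mmt_gen_funE.
  have mf : measurable_fun setT (fun w => (expR (l * Z (K%:R * h) w))%:E).
    exact: measurableT_comp (measurable_expR_scale l) _.
  rewrite -(big_mkord xpredT (fun k =>
    \int[P]_(w in seqDU E k) (expR (l * Z (K%:R * h) w))%:E)%E).
  rewrite -ge0_integral_bigsetU//.
  - by apply: ge0_subset_integral => //; exact: bigsetU_measurable.
  - exact: iota_uniq.
  - exact: sub_trivIset tA.
  - exact: measurable_funTS.
rewrite -lee_pdivlMl// => /le_trans; apply.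
rewrite -EFinM lee_fin /c expRN invfM invf_div -mulrA.
by rewrite -[X in _ * X]mulrA mulVf ?mulr1// gt_eqF// exprn_gt0.
Qed.

End maximal_inequality.

(** * From dyadic grids to continuous time *)

Section continuous_time.
Context d (Omega : measurableType d) (R : realType) (P : probability Omega R).
Variables (Z : R -> {RV P >-> R}) (HZ : levy_process Z).
Implicit Types s t h l x a : R.

(** The moment over a step [2 ^- m], raised to the power [2 ^ m], is [phi Z l]; an infinite moment
    over the step would make [phi Z l] infinite. *)
Lemma mmt_gen_fun_pow2_root l a m : 0 < a -> phi Z l = a%:E ->
  exists2 b : R, 0 < b &
    mmt_gen_fun P (Z (2 ^- m)) l = b%:E /\ b ^+ (2 ^ m) = a.
Proof.
move=> a0 aE.
have h0 : 0 <= 2 ^- m :> R by rewrite invr_ge0 exprn_ge0.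
have := mmt_gen_fun_mulrn HZ l (2 ^ m)%N h0.
rewrite natrX divff ?expf_neq0// -/(phi Z l) aE.
have : (0 <= mmt_gen_fun P (Z (2 ^- m)) l)%E.
  by rewrite mmt_gen_funE integral_ge0// => w _; rewrite lee_fin expR_ge0.
case: (mmt_gen_fun P _ l) => [b| |//].
- rewrite lee_fin -EFin_expe => b0 [ab]; exists b => //.
  rewrite lt_neqAle b0 andbT eq_sym; apply: contraPN a0 => /eqP b0'.
  by rewrite ab b0' expr0n expn_eq0/= ltxx.
- rewrite (_ : (2 ^ m)%N = (2 ^ m).-1.+1); last by rewrite prednK// expn_gt0.
  by move=> _; rewrite expeS gt0_mulye// expe_gt0// ltry.
Qed.

Lemma dyadic_between t e : 0 <= t -> 0 < e ->
  exists m k : nat, t < k%:R * 2 ^- m < t + e.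
Proof.
(* The mesh is below [e] because [e^-1 < m + 1 <= 2 ^ m]; [k] is the first grid index strictly after
   [t]. *)
move=> t0 e0; pose m := Num.truncn e^-1; pose k := (Num.truncn (t * 2 ^+ m)).+1.
have p0 : 0 < 2 ^+ m :> R by rewrite exprn_gt0.
exists m, k; rewrite ltr_pdivlMr// truncnS_gt/= ltr_pdivrMr// mulrDl.
rewrite /k -natr1 ler_ltD//; first by rewrite truncn_le mulr_ge0// ltW.
rewrite mulrC -ltr_pdivrMr// div1r (lt_le_trans (truncnS_gt _))//.
by rewrite -natrX ler_nat ltn_expl.
Qed.

(** A path at or above [x] at time [t] stays above [x - 1] shortly after [t], by right continuity,
    hence at some dyadic time; [t < n2] leaves room for it. The grid events increase with [m] and
    obey a bound free of [m]. Taking any measurable [F] avoids asking that the uncountable union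
    over times be measurable. *)
Lemma maximal_inequality l x a (n1 n2 : nat) (F : set Omega) :
  0 < l -> 0 < a -> phi Z l = a%:E -> (n1 <= n2)%N -> measurable F ->
  F `<=` [set w | exists2 t, n1%:R <= t < n2%:R & x <= Z t w] ->
  (P F <= (expR (- (l * (x - 1))) * Num.max (a ^+ n1) (a ^+ n2))%:E)%E.
Proof.
move=> l0 a0 aE n12 mF FZ.
pose E m := \bigcup_(k in [set k | (n1 * 2 ^ m <= k <= n2 * 2 ^ m)%N])
  [set w | x - 1 <= Z (k%:R * 2 ^- m) w].
have mE m : measurable (E m).
  apply: bigcup_measurable => k _.
  have := @measurable_fun_le _ Omega R setT (cst (x - 1)) _ measurableT
    (measurable_cst _) (measurable_funP (Z (k%:R * 2 ^- m))).
  by rewrite setTI.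
have h0 m : 0 <= 2 ^- m :> R by rewrite invr_ge0 exprn_ge0.
have PE m : (P (E m) <=
    (expR (- (l * (x - 1))) * Num.max (a ^+ n1) (a ^+ n2))%:E)%E.
  have [b b0 [bE <-]] := mmt_gen_fun_pow2_root m a0 aE.
  rewrite -!exprM ![(2 ^ m * _)%N]mulnC.
  apply: (discrete_maximal_inequality HZ) => //.
  by rewrite leq_mul2r n12 orbT.
have ndE : nondecreasing_seq E.
  apply/nondecreasing_seqP => m; apply/subsetPset => w [k /= /andP[k1 k2] xZ].
  exists (k * 2)%N => /=; first by rewrite expnSr !mulnA !leq_mul2r k1 k2 !orbT.
  by rewrite exprSr invfM natrM mulrACA divff// mulr1.
have : (P (\bigcup_m E m) <=
    (expR (- (l * (x - 1))) * Num.max (a ^+ n1) (a ^+ n2))%:E)%E.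
  have cE := nondecreasing_cvg_mu (mu := P) mE (bigcup_measurable (fun k _ => mE k)) ndE.
  rewrite -(cvg_lim _ cE)//; apply: lime_le; first by apply/cvg_ex; eexists; exact: cE.
  exact: nearW.
apply: le_trans; apply: le_measure; rewrite ?inE//; first exact: bigcup_measurable.
move=> w /FZ[t /andP[n1t tn2] xZ].
have t0 : 0 <= t by rewrite (le_trans _ n1t).
have : \forall s \near t^'+, x - 1 < Z s w.
  have := @levy_right_continuous _ _ _ _ _ HZ w t t0 => /cvgr_gt; apply.
  by rewrite (lt_le_trans _ xZ)// ltrBlDr ltrDl.
move=> [e /= e0 He].
pose e' := Num.min e (n2%:R - t).
have e'0 : 0 < e' by rewrite lt_min e0 subr_gt0.
have [m [k /andP[tk ke]]] := dyadic_between t0 e'0.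
exists m => //; exists k => /=.
  have p0 : 0 < 2 ^+ m :> R by rewrite exprn_gt0.
  rewrite -2!(ler_nat R) !natrM !natrX -ler_pdivlMr// -[X in _ && X]ler_pdivrMr//.
  rewrite (le_trans n1t (ltW tk))/= ltW// (lt_le_trans ke)//.
  by rewrite -lerBrDl ge_min lexx orbT.
apply/ltW/He => //=.
rewrite distrC ger0_norm ?subr_ge0 ?ltW// ltrBlDl (lt_le_trans ke)//.
by rewrite lerD2l ge_min lexx.
Qed.

End continuous_time.

(** * The exponent and the lower bound *)

Section difference_quotient.
Variable R : realType.
Implicit Types (f : R -> R) (a b c : R).

Lemma near_tangent f c e : derivable f c 1 -> 0 < e ->
  \forall h \near (0 : R), `|f (c + h) - f c - f^`()%classic c * h| <= e * `|h|.
Proof.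
move=> df e0; rewrite derive1E.
have : \forall h \near 0^', `|'D_1 f c - h^-1 * (f (h * 1 + c) - f c)| < e.
  by have /cvgr_dist_lt := df; apply.
move=> [r /= r0 Hr]; exists r => //= h hr.
have [->|h0] := eqVneq h 0; first by rewrite addr0 subrr mulr0 subrr normr0 mulr0.
have := Hr h hr h0; rewrite mulr1 [h + c]addrC => H.
rewrite -ler_pdivrMr ?normr_gt0// -normfV -normrM -normrN.
apply: le_trans (ltW H); rewrite le_eqVlt; apply/orP; left; apply/eqP.
by congr (`|_|); field.
Qed.

Lemma near_right_lt_tangent f c b : derivable f c 1 -> f^`()%classic c < b ->
  \forall h \near 0^'+, f (c + h) < f c + h * b.
Proof.
move=> df fb.
have e0 : 0 < (b - f^`()%classic c) / 2 by rewrite divr_gt0// subr_gt0.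
have [r /= r0 Hr] := near_tangent df e0; exists r => //= h hr h0.
have := Hr h hr; rewrite ler_norml (gtr0_norm h0) => /andP[_ H].
have : 0 < (b - f^`()%classic c) * h by rewrite mulr_gt0// subr_gt0.
lra.
Qed.

Lemma near_left_lt_tangent f c a : derivable f c 1 -> a < f^`()%classic c ->
  \forall h \near 0^'+, f (c - h) < f c - h * a.
Proof.
move=> df fa.
have e0 : 0 < (f^`()%classic c - a) / 2 by rewrite divr_gt0// subr_gt0.
have [r /= r0 Hr] := near_tangent df e0; exists r => //= h hr h0.
have hr' : `|0 - - h| < r by rewrite opprK add0r -normrN -sub0r.
have := Hr (- h) hr'; rewrite ler_norml normrN (gtr0_norm h0) => /andP[_ H].
have : 0 < (f^`()%classic c - a) * h by rewrite mulr_gt0// subr_gt0.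
lra.
Qed.

End difference_quotient.

Section exponent.
Context d (Omega : measurableType d) (R : realType) (P : probability Omega R).
Variables (Z : R -> {RV P >-> R}).
Implicit Types l : R.

Definition rpsi l : R := fine (psi Z l).

(** A zero integral would make a positive exponential vanish almost everywhere. *)
Lemma phi_gt0 l : (0 < phi Z l)%E.
Proof.
rewrite lt0e /phi mmt_gen_funE; apply/andP; split; last first.
  by apply: integral_ge0 => w _; exact: expR_scale_ge0.
have mf : measurable_fun setT (fun w => (expR (l * Z 1 w))%:E).
  by apply: measurableT_comp (measurable_expR_scale l) _.
apply/eqP => int0.
have /(ae_eq_integral_abs P measurableT mf)[A [mA PA0 nA]] :
    (\int[P]_w `|(expR (l * Z 1 w))%:E| = 0)%E.
  rewrite -{}int0; apply: eq_integral => w _; by rewrite gee0_abs// lee_fin expR_ge0.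
have : P setT = 0%E.
  rewrite -PA0; congr (P _); apply/seteqP; split => // w _; apply: nA => /=.
  by move=> /(_ I) /eqP; rewrite eqe expR_eq0.
by rewrite probability_setT => /eqP; rewrite onee_eq0.
Qed.

Lemma phiE l : Lambda Z l -> phi Z l = (expR (rpsi l))%:E.
Proof.
rewrite /Lambda /= /rpsi /psi; have := phi_gt0 l.
case: (phi Z l) => [r| |]//; rewrite lte_fin => r0 _.
by rewrite lne_EFin//= lnK// posrE.
Qed.

End exponent.

(** * Lower bound for the passage probability by exponential tilting *)

Section lower_bound.
Context d (Omega : measurableType d) (R : realType) (P : probability Omega R).
Variables (Z : R -> {RV P >-> R}) (HZ : levy_process Z).
Implicit Types l a b x h : R.

Lemma measurable_level t x : measurable [set w | x <= Z t w].
Proof.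
have := @measurable_fun_le _ Omega R setT (cst x) _ measurableT
  (measurable_cst _) (measurable_funP (Z t)).
by rewrite setTI.
Qed.

Lemma mmt_gen_fun_nat l n : Lambda Z l ->
  mmt_gen_fun P (Z n%:R) l = (expR (rpsi Z l) ^+ n)%:E.
Proof.
move=> Ll; have := mmt_gen_fun_mulrn HZ l n ler01.
by rewrite mulr1 => ->; rewrite -/(phi Z l) phiE// EFin_expe.
Qed.

(* Exponential Chebyshev bounds with parameters [l + h] and [l - h] confine the
   mass of [expR (l * Z n)] to [n a <= Z n <= n b]. *)
Lemma level_prob_ge_trim l a b h n : 0 < l -> 0 < h ->
  Lambda Z l -> Lambda Z (l + h) -> Lambda Z (l - h) ->
  expR (rpsi Z l) ^+ n <=
  expR (rpsi Z (l + h) - h * b) ^+ n + expR (rpsi Z (l - h) + h * a) ^+ n +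
  expR (l * b) ^+ n * fine (P [set w | (n%:R * a <= Z n%:R w)%R]).
Proof.
move=> l0 h0 Ll Llh Llh'.
set A := [set w | _]; have mA : measurable A by exact: measurable_level.
have mZ s : measurable_fun setT (fun w => (expR (s * Z n%:R w))%:E).
  by apply: measurableT_comp (measurable_expR_scale s) _.
have pointwise w : ((expR (l * Z n%:R w))%:E <=
    (expR (- (h * b)) ^+ n)%:E * (expR ((l + h) * Z n%:R w))%:E +
    (expR (h * a) ^+ n)%:E * (expR ((l - h) * Z n%:R w))%:E +
    (expR (l * b) ^+ n)%:E * (\1_A w)%:E)%E.
  rewrite -!EFinM -!EFinD lee_fin -!expRM_natl -!expRD.
  set z := Z n%:R w.
  (* Above [n b] the first term alone dominates, between [n a] and [n b] the third, below [n a] the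
     second. *)
  have [bz|zb] := ltP (n%:R * b) z.
    rewrite -addrA ler_wpDr//.
    rewrite ler_expR; have : 0 <= h * (z - n%:R * b).
      by apply: mulr_ge0; [exact: ltW|rewrite subr_ge0 ltW].
    lra.
  have [az|za] := leP (n%:R * a) z.
    rewrite indicE mem_set// mulr1 ler_wpDl//.
    rewrite ler_expR mulrCA ler_pM2l//.
  rewrite addrAC ler_wpDl//.
  rewrite ler_expR; have : 0 <= h * (n%:R * a - z).
    by apply: mulr_ge0; [exact: ltW|rewrite subr_ge0 ltW].
  lra.
rewrite -lee_fin -mmt_gen_fun_nat// mmt_gen_funE.
have E1 (c s : R) : 0 <= c -> Lambda Z s ->
    (\int[P]_w (c%:E * (expR (s * Z n%:R w))%:E) =
     (c * expR (rpsi Z s) ^+ n)%:E)%E.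
  by move=> c0 Ls; rewrite ge0_integralZl// -mmt_gen_funE mmt_gen_fun_nat.
have m1 (c s : R) : measurable_fun setT (fun w => c%:E * (expR (s * Z n%:R w))%:E)%E.
  exact: measurable_funeM.
have p1 (c s : R) w : 0 <= c -> (0 <= c%:E * (expR (s * Z n%:R w))%:E)%E.
  by move=> c0; rewrite mule_ge0 ?lee_fin ?expR_ge0.
have m2 : measurable_fun setT (fun w => (expR (l * b) ^+ n)%:E * (\1_A w)%:E)%E.
  apply: measurable_funeM; apply/measurable_EFinP; exact: measurable_indic.
apply: (@le_trans _ _ (\int[P]_w
    ((expR (- (h * b)) ^+ n)%:E * (expR ((l + h) * Z n%:R w))%:E +
    (expR (h * a) ^+ n)%:E * (expR ((l - h) * Z n%:R w))%:E +
    (expR (l * b) ^+ n)%:E * (\1_A w)%:E))%E).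
  apply: ge0_le_integral => //.
  by apply: emeasurable_funD => //; exact: emeasurable_funD.
rewrite ge0_integralD//; last 2 first.
- by move=> w _; rewrite adde_ge0// p1// exprn_ge0// expR_ge0.
- exact: emeasurable_funD.
rewrite ge0_integralD//.
rewrite !E1 ?exprn_ge0 ?expR_ge0//.
rewrite ge0_integralZl//; last by apply/measurable_EFinP; exact: measurable_indic.
rewrite integral_indic// setIT.
have PA : P A = (fine (P A))%:E by rewrite fineK//; exact: fin_num_measure.
rewrite [X in (_ + _ * X <= _)%E]PA.
rewrite -EFinM -!EFinD lee_fin -!exprMn -!expRD.
by rewrite [- _ + _]addrC [h * a + _]addrC.
Qed.

(** As the derivative lies strictly between [a] and [b], a small [h] makes both error terms of
    [level_prob_ge_trim] geometrically small relative to the total mass; once they take at most half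
    of it, the other half bounds the probability. *)
Lemma level_prob_ge l a b : Lambda_plus Z l -> derivable (rpsi Z) l 1 ->
  a < dpsi Z l < b ->
  \forall n \near \oo, expR (rpsi Z l - l * b) ^+ n / 2 <=
    fine (P [set w | (n%:R * a <= Z n%:R w)%R]).
Proof.
move=> [/= l0 Ll] dl /andP[al lb].
have Ll0 : Lambda Z l by exact: nbhs_singleton Ll.
have nearL : \forall h \near 0^'+, Lambda Z (l + h) /\ Lambda Z (l - h).
  have [e /= e0 He] : nbhs l (Lambda Z) by [].
  exists e => //= h he h0; split; apply: He => /=.
    by rewrite opprD addrA subrr add0r -sub0r.
  by rewrite opprB addrC subrK -normrN -sub0r.
have [h [h0 [[Lh Lh'] [h1 h2]]]] : exists h, 0 < h /\
   ((Lambda Z (l + h) /\ Lambda Z (l - h)) /\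
    (rpsi Z (l + h) < rpsi Z l + h * b /\ rpsi Z (l - h) < rpsi Z l - h * a)).
  apply: (@filter_ex _ (0^'+ : set_system R)); near=> h.
  split; first by near: h; exact: nbhs_right_gt.
  split; first by near: h.
  split; near: h; first exact: near_right_lt_tangent.
  exact: near_left_lt_tangent.
pose r1 := expR (rpsi Z (l + h) - h * b - rpsi Z l).
pose r2 := expR (rpsi Z (l - h) + h * a - rpsi Z l).
have r1c : r1 ^+ n @[n --> \oo] --> (0 : R).
  by apply: cvg_expr; rewrite ger0_norm ?expR_ge0// expR_lt1; lra.
have r2c : r2 ^+ n @[n --> \oo] --> (0 : R).
  by apply: cvg_expr; rewrite ger0_norm ?expR_ge0// expR_lt1; lra.
have r12 : \forall n \near \oo, r1 ^+ n + r2 ^+ n < 2^-1.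
  have rc : r1 ^+ n + r2 ^+ n @[n --> \oo] --> (0 : R).
    by rewrite -[X in _ --> X]addr0; exact: cvgD.
  by apply: (cvgr_lt _ rc); rewrite invr_gt0.
near=> n.
have := level_prob_ge_trim a b n l0 h0 Ll0 Lh Lh'.
set p := fine _ => H.
have Hr : r1 ^+ n + r2 ^+ n <= 2^-1 by apply: ltW; near: n.
have E0 : 0 < expR (rpsi Z l) ^+ n by rewrite exprn_gt0 ?expR_gt0.
have E1 : expR (rpsi Z (l + h) - h * b) ^+ n = expR (rpsi Z l) ^+ n * r1 ^+ n.
  by rewrite -exprMn -expRD; congr (expR _ ^+ n); lra.
have E2 : expR (rpsi Z (l - h) + h * a) ^+ n = expR (rpsi Z l) ^+ n * r2 ^+ n.
  by rewrite -exprMn -expRD; congr (expR _ ^+ n); lra.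
rewrite expRD exprMn expRN exprVn mulrAC ler_pdivrMr ?exprn_gt0 ?expR_gt0//.
rewrite [p * _]mulrC; move: H; rewrite E1 E2 -mulrDr.
have := ler_wpM2l (ltW E0) Hr; lra.
Unshelve. all: by end_near. Qed.

Lemma tau_le_of_level x T n w : n%:R <= T -> x <= Z n%:R w ->
  (tau Z x w <= T%:E)%E.
Proof.
move=> nT xZ; apply: (@le_trans _ _ n%:R%:E); last by rewrite lee_fin.
by apply: ereal_inf_lbound; exists n%:R.
Qed.

Hypothesis Htau : forall x : R, measurable_fun [set: Omega] (tau Z x).

Lemma measurable_tau_le x T : measurable [set w | (tau Z x w <= T%:E)%E].
Proof.
rewrite -[X in measurable X]setTI.
exact: emeasurable_fun_infty_c measurableT (Htau x) _.
Qed.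

(** Apply [level_prob_ge] at the integer time [n] just after [x / a], where [x <= n a]. Rounding
    costs the constant [expR (- (l * b))], and [0 <= rpsi Z l] allows [n] to be replaced by [x / a]
    in the other part of the exponent. *)
Lemma tau_prob_ge l a b : Lambda_plus Z l -> derivable (rpsi Z) l 1 ->
  0 <= rpsi Z l -> 0 < a -> a < dpsi Z l < b ->
  \forall x \near +oo, expR (- (l * b)) / 2 * expR (- ((l * b - rpsi Z l) / a * x)) <=
    fine (P [set w | (tau Z x w <= (x / a + 1)%:E)%E]).
Proof.
move=> Ll dl psi0 a0 adb; have l0 : 0 < l by case: Ll.
have b0 : 0 < b by case/andP : adb => /(lt_trans a0)/lt_trans; apply.
have [N _ HN] := level_prob_ge Ll dl adb.
near=> x.
have x0 : 0 <= x by near: x; apply: nbhs_pinfty_ge; exact: num_real.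
pose n := (Num.truncn (x / a)).+1.
have nx : x / a < n%:R by exact: truncnS_gt.
have nx1 : n%:R <= x / a + 1.
  by rewrite /n -natr1 lerD2r truncn_le divr_ge0// ltW.
have Nn : (N <= n)%N.
  rewrite -(ler_nat R) (le_trans _ (ltW nx))// ler_pdivlMr//.
apply: le_trans (le_trans (HN n Nn) _); last first.
  apply: fine_le; rewrite ?fin_num_measure//.
  - exact: measurable_level.
  - exact: measurable_tau_le.
  - apply: le_measure; rewrite ?inE//; first exact: measurable_level.
      exact: measurable_tau_le.
    move=> w /=; move: nx; rewrite ltr_pdivrMr// => /ltW nx nZ.
    exact: tau_le_of_level nx1 (le_trans nx nZ).
rewrite mulrAC ler_pM2r ?invr_gt0// -expRD -expRM_natl ler_expR.
have H1 : l * b * n%:R <= l * b * (x / a + 1) by rewrite ler_pM2l// mulr_gt0.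
have H2 : rpsi Z l * (x / a) <= rpsi Z l * n%:R by rewrite ler_wpM2l// ltW.
have -> : (l * b - rpsi Z l) / a * x = (l * b - rpsi Z l) * (x / a).
  by rewrite mulrAC mulrA.
lra.
Unshelve. all: by end_near. Qed.

End lower_bound.

(** * Strict convexity of the exponent *)

(** Average the tangent bounds taken at the barycentre [c]. *)
Lemma expR_convex (R : realType) (t a b : R) : 0 <= t <= 1 ->
  expR ((1 - t) * a + t * b) <= (1 - t) * expR a + t * expR b.
Proof.
move=> /andP[t0 t1]; set c := (1 - t) * a + t * b.
have tangent z : expR c * (1 + (z - c)) <= expR z.
  by rewrite -[z in leRHS](subrKC c) [expR (c + _)]expRD ler_pM2l ?expR_gt0// expR_ge1Dx.
have ta := ler_wpM2l (eqbRL (subr_ge0 _ _) t1) (tangent a).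
have tb := ler_wpM2l t0 (tangent b).
apply: le_trans (lerD ta tb); rewrite le_eqVlt; apply/orP; left; apply/eqP.
by rewrite /c; ring.
Qed.

Section convexity.
Context d (Omega : measurableType d) (R : realType) (P : probability Omega R).
Variables (Z : R -> {RV P >-> R}).
Variables (mu sigma : R) (Pi : {measure set R -> \bar R}).
Hypothesis HLK : levy_khintchine Z mu sigma Pi.
Implicit Types l u v t y : R.

Definition lk_integrand l y := expR (l * y) - 1 - l * y * (`|y| <= 1)%R%:R.

Lemma measurable_lk_integrand l : measurable_fun setT (lk_integrand l).
Proof.
apply: measurable_funB.
  by apply: measurable_funB => //; apply: measurableT_comp.
apply: measurable_funM => //.
have -> : (fun y : R => (`|y| <= 1)%R%:R) = \1_([set y : R | `|y| <= 1]) :> (R -> R).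
  apply/funext => y; rewrite indicE; congr ((nat_of_bool _)%:R).
  by apply/idP/idP => [y1|]; [rewrite mem_set|rewrite inE].
apply: measurable_indic; rewrite -[X in measurable X]setTI.
exact: measurable_fun_le.
Qed.

Lemma psiE l : Lambda Z l -> psi Z l = (rpsi Z l)%:E.
Proof. by move=> Ll; rewrite {1}/psi phiE// lne_EFin ?expR_gt0// expRK. Qed.

(** The Lévy-Khintchine equation forces the integral to be finite on [Lambda], hence both its
    positive and its negative part. *)
Lemma lk_integrable l : Lambda Z l ->
  Pi.-integrable setT (EFin \o lk_integrand l).
Proof.
move=> Ll; have mk : measurable_fun setT (EFin \o lk_integrand l).
  by apply/measurable_EFinP; exact: measurable_lk_integrand.
apply/integrableP; split => //.
have : (\int[Pi]_y (EFin \o lk_integrand l) y)%E \is a fin_num.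
  have := HLK Ll; rewrite psiE//.
  by case: integral.
rewrite integralE fin_numB => /andP[pf nf].
rewrite -[X in integral _ _ X]/(abse \o (EFin \o lk_integrand l)) fune_abse.
rewrite ge0_integralD//.
- by rewrite lte_add_pinfty// ltey_eq ?pf ?nf.
- exact: measurable_funepos.
- exact: measurable_funeneg.
Qed.

Definition lk_part l := fine (\int[Pi]_y (lk_integrand l y)%:E)%E.

Lemma rpsiE l : Lambda Z l ->
  rpsi Z l = - mu * l + (sigma * l) ^+ 2 / 2 + lk_part l.
Proof.
move=> Ll; have := HLK Ll; rewrite psiE// /lk_part.
have := integrable_fin_num measurableT (lk_integrable Ll).
by case: integral => // r _ [].
Qed.

(** For fixed [y] the integrand is an exponential plus an affine function of [l]. *)
Lemma lk_part_convex t u v : 0 <= t <= 1 -> Lambda Z u -> Lambda Z v ->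
  Lambda Z ((1 - t) * u + t * v) ->
  lk_part ((1 - t) * u + t * v) <= (1 - t) * lk_part u + t * lk_part v.
Proof.
move=> t01 Lu Lv Lw; set w := _ + _ in Lw *.
have [Iu Iv Iw] := And3 (lk_integrable Lu) (lk_integrable Lv) (lk_integrable Lw).
have Ifin s : Lambda Z s -> ((lk_part s)%:E = \int[Pi]_y (EFin \o lk_integrand s) y)%E.
  by move=> /lk_integrable Is; rewrite fineK//; exact: integrable_fin_num.
rewrite -lee_fin EFinD !EFinM !Ifin// -!integralZl// -integralD//; last 2 first.
- exact: integrableZl.
- exact: integrableZl.
apply: le_integral => //.
- by apply: integrableD => //; exact: integrableZl.
move=> y _ /=; rewrite -!EFinM -EFinD lee_fin /lk_integrand /w.
have := expR_convex (u * y) (v * y) t01.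
rewrite (_ : (1 - t) * (u * y) + t * (v * y) = ((1 - t) * u + t * v) * y); last by ring.
set A := expR _; set B := expR _; set C := expR _; set k := (_%:R : R).
lra.
Qed.

Lemma Lambda_convex t u v : 0 <= t <= 1 -> Lambda Z u -> Lambda Z v ->
  Lambda Z ((1 - t) * u + t * v).
Proof.
move=> t01 Lu Lv; rewrite /Lambda/= /phi mmt_gen_funE.
have mZ s : measurable_fun setT (fun w => (expR (s * Z 1 w))%:E).
  by apply: measurableT_comp (measurable_expR_scale s) _.
have /andP[t0 t1] := t01.
apply: (@le_lt_trans _ _ (\int[P]_w ((1 - t)%:E * (expR (u * Z 1 w))%:E +
   t%:E * (expR (v * Z 1 w))%:E))%E).
  apply: ge0_le_integral => //.
  - by apply: emeasurable_funD; exact: measurable_funeM.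
  - move=> w _; rewrite -!EFinM -EFinD lee_fin.
    apply: le_trans (expR_convex _ _ t01).
    by rewrite ler_expR le_eqVlt; apply/orP; left; apply/eqP; ring.
have t1' : 0 <= 1 - t by rewrite subr_ge0.
rewrite ge0_integralD//; last 4 first.
- by move=> w _; rewrite mule_ge0// lee_fin// expR_ge0.
- exact: measurable_funeM.
- by move=> w _; rewrite mule_ge0// lee_fin// expR_ge0.
- exact: measurable_funeM.
rewrite !ge0_integralZl//.
by rewrite lte_add_pinfty// lte_mul_pinfty// ?lee_fin// -mmt_gen_funE.
Qed.

(** Strong convexity: the jump part is convex and the Gaussian part contributes its exact quadratic
    term. Otherwise let [D > 0] be the defect; comparing the chord bound at [u + t e] with the
    tangent at [u] gives [t D <= t D / 2] for small [t]. *)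
Lemma rpsi_tangent u v : Lambda Z u -> Lambda Z v -> derivable (rpsi Z) u 1 ->
  rpsi Z u + dpsi Z u * (v - u) + (sigma * (v - u)) ^+ 2 / 2 <= rpsi Z v.
Proof.
move=> Lu Lv du; rewrite leNgt; apply/negP => vlt.
set e := v - u in vlt *.
have [e0|e0] := eqVneq e 0.
  move: vlt; rewrite e0 !mulr0 expr0n/= mul0r !addr0.
  by move/eqP: e0; rewrite subr_eq0 => /eqP ->; rewrite ltxx.
set D := rpsi Z u + dpsi Z u * e + (sigma * e) ^+ 2 / 2 - rpsi Z v.
have D0 : 0 < D by rewrite subr_gt0.
have eps0 : 0 < D / 4 / `|e| by rewrite !divr_gt0// normr_gt0.
have near0 := near_tangent du eps0.
(* For such [t], the tangent error and the second-order Gaussian term are each at most [t D / 4]. *)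
have [t [t0 [t1 [tD Ht]]]] : exists t : R, 0 < t /\ (t <= 1 /\
   (t * ((sigma * e) ^+ 2 / 2) <= D / 4 /\
   `|rpsi Z (u + t * e) - rpsi Z u - dpsi Z u * (t * e)| <= D / 4 / `|e| * `|t * e|)).
  have te c : t * c @[t --> 0^'+] --> (0 : R).
    rewrite -[X in _ --> X](mul0r c); apply: cvgMl.
    exact: cvg_at_right_filter.
  apply: (@filter_ex _ (0^'+ : set_system R)); near=> t.
  split; first by near: t; exact: nbhs_right_gt.
  split; first by near: t; exact: nbhs_right_le.
  split; near: t; last exact: (te e _ near0).
  by apply: (cvgr_le _ (te _)); rewrite divr_gt0.
have t01 : 0 <= t <= 1 by rewrite t1 ltW.
have wE : u + t * e = (1 - t) * u + t * v by rewrite /e; ring.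
have Lw := Lambda_convex t01 Lu Lv.
have cv := lk_part_convex t01 Lu Lv Lw.
have := rpsiE Lu; have := rpsiE Lv; have := rpsiE Lw.
rewrite -wE in cv *; move=> Ew Ev Eu.
have : t * D <= t * (D / 4) + t * (D / 4).
  have H1 : - (t * (D / 4)) <= rpsi Z (u + t * e) - rpsi Z u - dpsi Z u * (t * e).
    move: Ht; rewrite ler_norml => /andP[+ _]; apply: le_trans.
    rewrite normrM (gtr0_norm t0) (_ : _ * (t * _) = t * (D / 4))//.
    by field; rewrite normr_eq0.
  have H2 : t * (t * ((sigma * e) ^+ 2 / 2)) <= t * (D / 4) by rewrite ler_pM2l.
  have vE : v = u + e by rewrite /e; ring.
  have H3 : rpsi Z (u + t * e) <= rpsi Z u + t * (rpsi Z v - rpsi Z u)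
     - t * ((sigma * e) ^+ 2 / 2) + t * (t * ((sigma * e) ^+ 2 / 2)).
    rewrite Ew Eu Ev; apply: le_trans (lerD (lexx _) cv) _.
    by rewrite vE le_eqVlt; apply/orP; left; apply/eqP; field.
  rewrite {1}/D; lra.
have : 0 < t * D by rewrite mulr_gt0.
lra.
Unshelve. all: by end_near. Qed.

End convexity.

(** * Regularity of the exponent, inherited from that of [phi] *)

Section exponent_regularity.
Context d (Omega : measurableType d) (R : realType) (P : probability Omega R).
Variables (Z : R -> {RV P >-> R}).
Hypothesis Hdiff : forall l : R, Lambda_plus Z l ->
  derivable (rphi Z) l 1 /\ derivable (rphi Z)^`()%classic l 1.
Implicit Types l u v : R.

Lemma Lambda_plus_sub l : Lambda_plus Z l -> Lambda Z l.
Proof. by move=> [_]; exact: interior_subset. Qed.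

Lemma Lambda_plus_near l : Lambda_plus Z l -> \forall s \near l, Lambda_plus Z s.
Proof.
move=> [l0 Ll]; near=> s; split; near: s; first exact: lt_nbhsr.
by apply: open_nbhs_nbhs; split => //; exact: open_interior.
Unshelve. all: by end_near. Qed.

Lemma rphiE l : Lambda Z l -> rphi Z l = expR (rpsi Z l).
Proof. by move=> Ll; rewrite /rphi phiE. Qed.

Lemma is_derive_rpsi l : Lambda_plus Z l ->
  is_derive l 1 (rpsi Z) ((rphi Z l)^-1 * (rphi Z)^`()%classic l).
Proof.
move=> Ll; have [dl _] := Hdiff Ll.
have rl : 0 < rphi Z l by rewrite rphiE ?expR_gt0//; exact: Lambda_plus_sub.
have dln : derivable (@ln R) (rphi Z l) 1.
  by apply: ex_derive; exact: is_derive1_ln.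
apply: (@near_eq_is_derive _ _ _ (@ln R \o rphi Z)).
  near=> s; have Ls : Lambda_plus Z s by near: s; exact: Lambda_plus_near.
  by rewrite /= rphiE ?expRK//; exact: Lambda_plus_sub.
apply: DeriveDef.
  apply/derivable1_diffP; apply: differentiable_comp.
    by apply/derivable1_diffP; exact: dl.
  by apply/derivable1_diffP; exact: dln.
rewrite -derive1E (derive1_comp dl dln) [X in X * _]derive1E.
by have [_ ->] := is_derive1_ln rl.
Unshelve. all: by end_near. Qed.

Lemma derivable_rpsi l : Lambda_plus Z l -> derivable (rpsi Z) l 1.
Proof. by move=> /is_derive_rpsi[]. Qed.

Lemma dpsiE l : Lambda_plus Z l ->
  dpsi Z l = (rphi Z l)^-1 * (rphi Z)^`()%classic l.
Proof. by move=> /is_derive_rpsi[_ <-]; rewrite /dpsi derive1E. Qed.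

Lemma continuous_rpsi l : Lambda_plus Z l -> {for l, continuous (rpsi Z)}.
Proof.
move=> Ll; apply: differentiable_continuous; apply/derivable1_diffP.
exact: derivable_rpsi Ll.
Qed.

(** Here the second derivative of [phi] enters: it makes the numerator of the logarithmic derivative
    continuous. *)
Lemma continuous_dpsi l : Lambda_plus Z l -> {for l, continuous (dpsi Z)}.
Proof.
move=> Ll; have [dl ddl] := Hdiff Ll.
have rl : rphi Z l != 0.
  by rewrite rphiE ?gt_eqF ?expR_gt0//; exact: Lambda_plus_sub.
have cr : {for l, continuous (rphi Z)}.
  by apply: differentiable_continuous; apply/derivable1_diffP; exact: dl.
have cdr : {for l, continuous (rphi Z)^`()%classic}.
  by apply: differentiable_continuous; apply/derivable1_diffP; exact: ddl.
have : (rphi Z s)^-1 * (rphi Z)^`()%classic s @[s --> l] --> dpsi Z l.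
  rewrite dpsiE//; apply: cvgM => //; exact: cvgV.
rewrite /prop_for/= /continuous_at; apply: cvg_trans; apply: near_eq_cvg.
by near=> s; rewrite dpsiE//; near: s; exact: Lambda_plus_near.
Unshelve. all: by end_near. Qed.

End exponent_regularity.

Section exponent_roots.
Context d (Omega : measurableType d) (R : realType) (P : probability Omega R).
Variables (Z : R -> {RV P >-> R}).
Variables (mu sigma : R) (Pi : {measure set R -> \bar R}).
Hypotheses (Hsigma : 0 < sigma) (HLK : levy_khintchine Z mu sigma Pi).
Hypothesis Hdiff : forall l : R, Lambda_plus Z l ->
  derivable (rphi Z) l 1 /\ derivable (rphi Z)^`()%classic l 1.
Variable lstar : R.
Hypotheses (Hlstar : Lambda_plus Z lstar) (Hpsi : psi Z lstar = 0%E).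
Implicit Types l u v : R.

Lemma phi0 : phi Z 0 = 1%E.
Proof.
rewrite /phi mmt_gen_funE; under eq_integral do rewrite mul0r expR0.
by rewrite integral_cst// mul1e; exact: probability_setT.
Qed.

Lemma Lambda0 : Lambda Z 0.
Proof. by rewrite /Lambda/= phi0 ltry. Qed.

Lemma rpsi0 : rpsi Z 0 = 0.
Proof. by rewrite /rpsi /psi phi0 lne1. Qed.

Lemma rpsi_lstar : rpsi Z lstar = 0.
Proof. by rewrite /rpsi Hpsi. Qed.

(** Adding the tangent inequalities at [u] and at [v] leaves the positive Gaussian term. *)
Lemma dpsi_lt u v : Lambda_plus Z u -> Lambda_plus Z v -> u < v ->
  dpsi Z u < dpsi Z v.
Proof.
move=> Lu Lv uv; have [Lu' Lv'] := (Lambda_plus_sub Lu, Lambda_plus_sub Lv).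
have H1 := rpsi_tangent HLK Lu' Lv' (derivable_rpsi Hdiff Lu).
have H2 := rpsi_tangent HLK Lv' Lu' (derivable_rpsi Hdiff Lv).
have uv0 : 0 < v - u by rewrite subr_gt0.
have s0 : 0 < (sigma * (v - u)) ^+ 2 by rewrite exprn_gt0// mulr_gt0.
rewrite -subr_gt0 -(pmulr_lgt0 _ uv0).
move: (dpsi Z u) (dpsi Z v) (rpsi Z u) (rpsi Z v) H1 H2 => du dv pu pv H1 H2.
have -> : (dv - du) * (v - u) = - (du * (v - u) + dv * (u - v)) by ring.
have sE : (sigma * (u - v)) ^+ 2 = (sigma * (v - u)) ^+ 2 by ring.
rewrite sE in H2; lra.
Qed.

(** Evaluate the tangent inequality at [lstar] in 0, the other zero of [rpsi Z]. *)
Lemma dpsi_lstar_gt0 : 0 < dpsi Z lstar.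
Proof.
have l0 : 0 < lstar by case: Hlstar.
have := rpsi_tangent HLK (Lambda_plus_sub Hlstar) Lambda0 (derivable_rpsi Hdiff Hlstar).
rewrite rpsi0 rpsi_lstar sub0r add0r mulrN => H.
have : 0 < (sigma * - lstar) ^+ 2 by rewrite mulrN sqrrN exprn_gt0// mulr_gt0.
by move=> H'; rewrite -(pmulr_lgt0 _ l0); lra.
Qed.

Lemma rpsi_gt0 l : Lambda_plus Z l -> lstar < l -> 0 < rpsi Z l.
Proof.
move=> Ll ll; apply: lt_le_trans (rpsi_tangent HLK (Lambda_plus_sub Hlstar)
  (Lambda_plus_sub Ll) (derivable_rpsi Hdiff Hlstar)).
rewrite rpsi_lstar add0r ltr_wpDr//; last by rewrite mulr_gt0 ?dpsi_lstar_gt0// subr_gt0.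
by rewrite divr_ge0// sqr_ge0.
Qed.

End exponent_roots.

(** * Upper bounds for the law of the first passage time *)

Section first_passage_law.
Context d (Omega : measurableType d) (R : realType) (P : probability Omega R).
Variables (Z : R -> {RV P >-> R}) (HZ : levy_process Z).
Hypothesis Htau : forall x : R, measurable_fun [set: Omega] (tau Z x).
Implicit Types l x T : R.

Lemma tau_lt_level x T w : (tau Z x w < T%:E)%E ->
  exists t, [/\ 0 <= t, t < T, (tau Z x w <= t%:E)%E & x <= Z t w].
Proof.
move=> /ereal_inf_lt[_ [t [t0 xZ] <-]]; rewrite lte_fin => tT; exists t; split => //.
by apply: ereal_inf_lbound; exists t.
Qed.

Lemma tau_prob_le l x T : 0 < l -> Lambda Z l -> 0 <= rpsi Z l -> 0 <= T ->
  fine (P [set w | (tau Z x w <= T%:E)%E]) <=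
  expR (l + rpsi Z l) * expR (rpsi Z l * T - l * x).
Proof.
(* [n] lies strictly after [T]: the infimum defining [tau] need not be attained, so [tau Z x w <= T]
   only yields passages at times below [n]. Rounding costs [expR (rpsi Z l)], lowering the level
   costs [expR l]. *)
move=> l0 Ll psi0 T0; pose n := (Num.truncn T).+1.
have nT : T < n%:R by exact: truncnS_gt.
have nT1 : n%:R <= T + 1 by rewrite /n -natr1 lerD2r truncn_le.
have := @maximal_inequality _ _ _ _ _ HZ l x (expR (rpsi Z l)) 0 n _ l0
  (expR_gt0 _) (phiE Ll) (leq0n _) (measurable_tau_le Htau x T).
move=> H; have {}H := H _.
have {}H : (P [set w | (tau Z x w <= T%:E)%E] <= (expR (- (l * (x - 1))) *
   Num.max (expR (rpsi Z l) ^+ 0) (expR (rpsi Z l) ^+ n))%:E)%E.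
  apply: H => w /= wT.
  have wn : (tau Z x w < n%:R%:E)%E by rewrite (le_lt_trans wT)// lte_fin.
  have [t [t0 tn _ xZ]] := tau_lt_level wn.
  by exists t => //; rewrite t0.
have mT := measurable_tau_le Htau x T.
rewrite -[P _]fineK ?fin_num_measure// lee_fin in H.
apply: le_trans H _; rewrite expr0 max_r; last by rewrite exprn_ege1// -expR0 ler_expR.
rewrite -expRM_natl -!expRD ler_expR.
have := ler_wpM2r psi0 nT1; lra.
Qed.

(** With a nonpositive exponent the maximum in [maximal_inequality] sits at the left endpoint, so
    the bound does not involve [T2]; rounding [T1] down costs [expR (- rpsi Z l)]. *)
Lemma tau_prob_between l x T1 T2 : 0 < l -> Lambda Z l -> rpsi Z l <= 0 ->
  0 <= T1 -> T1 <= T2 ->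
  fine (P [set w | (tau Z x w <= T2%:E)%E]) -
  fine (P [set w | (tau Z x w <= T1%:E)%E]) <=
  expR (l - rpsi Z l) * expR (rpsi Z l * T1 - l * x).
Proof.
move=> l0 Ll psi0 T10 T12; pose n1 := Num.truncn T1; pose n2 := (Num.truncn T2).+1.
have n1T : n1%:R <= T1 by rewrite truncn_le.
have Tn1 : T1 < n1%:R + 1 by rewrite natr1; exact: truncnS_gt.
have nT2 : T2 < n2%:R by exact: truncnS_gt.
have n12 : (n1 <= n2)%N by rewrite /n1 /n2 ltnW// ltnS le_truncn.
have [m1 m2] := (measurable_tau_le Htau x T1, measurable_tau_le Htau x T2).
have := @maximal_inequality _ _ _ _ _ HZ l x (expR (rpsi Z l)) n1 n2
  ([set w | (tau Z x w <= T2%:E)%E] `\` [set w | (tau Z x w <= T1%:E)%E]) l0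
  (expR_gt0 _) (phiE Ll) n12 (measurableD m2 m1).
have sub12 : [set w | (tau Z x w <= T1%:E)%E] `<=` [set w | (tau Z x w <= T2%:E)%E].
  by move=> w /= /le_trans; apply; rewrite lee_fin.
rewrite measureD// ?(setIidr sub12) ?(le_lt_trans (probability_le1 _ _)) ?ltry//.
set C := Num.max _ _ => H.
have {}H : (P [set w | (tau Z x w <= T2%:E)%E] - P [set w | (tau Z x w <= T1%:E)%E] <=
    (expR (- (l * (x - 1))) * C)%:E)%E.
  apply: H => w [/= wT2 /negP]; rewrite -ltNge => T1w.
  have wn : (tau Z x w < n2%:R%:E)%E by rewrite (le_lt_trans wT2)// lte_fin.
  have [t [t0 tn wt xZ]] := tau_lt_level wn.
  exists t => //; rewrite tn andbT; have := lt_le_trans T1w wt.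
  by rewrite lte_fin => /ltW; exact: le_trans.
have F1 := fin_num_measure P _ m1; have F2 := fin_num_measure P _ m2.
rewrite -(fineK F1) -(fineK F2) -EFinB lee_fin in H.
apply: le_trans H _; rewrite /C max_l; last by rewrite ler_wiXn2l ?expR_ge0// expR_le1.
rewrite -expRM_natl -!expRD ler_expR.
have := ler_wnM2r psi0 (ltW Tn1); lra.
Qed.

End first_passage_law.

(** * The two regimes *)

Section spatial_asymptotics.
Context d (Omega : measurableType d) (R : realType) (P : probability Omega R).
Variables (Z : R -> {RV P >-> R}) (l : R) (B : R -> R).
Hypothesis HB : class_L Z l B.
Implicit Types a b c e x : R.

Lemma class_L_dist e : 0 < e ->
  \forall x \near +oo, 0 <= B x /\ `|x - dpsi Z l * B x| <= e * (1 + B x).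
Proof.
move=> e0; have [B0 /eqoP/(_ e e0) Bo] := HB.
near=> x; have Bx : 0 <= B x by near: x.
split=> //; apply: (@le_trans _ _ (e * `|Num.sqrt (B x)|)); first by near: x.
rewrite ler_pM2l// ger0_norm ?sqrtr_ge0//.
have := sqr_sqrtr Bx; have : 0 <= (Num.sqrt (B x) - 1) ^+ 2 by exact: sqr_ge0.
nra.
Unshelve. all: by end_near. Qed.

Lemma class_L_ge a c : 0 < a -> dpsi Z l < a ->
  \forall x \near +oo, x / a + c <= B x.
Proof.
(* The maximum with 0 keeps [m] positive even if [dpsi Z l <= 0]. The slack [m^-1 - a^-1] absorbs
   the constants for large [x]. *)
move=> a0 la; pose m := (Num.max (dpsi Z l) 0 + a) / 2.
have ma : m < a.
  have : Num.max (dpsi Z l) 0 < a by rewrite gt_max la.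
  by rewrite /m; lra.
have m0 : 0 < m.
  by have : 0 <= Num.max (dpsi Z l) 0; [rewrite le_max lexx orbT|rewrite /m; lra].
have lm : dpsi Z l < m.
  by have : dpsi Z l <= Num.max (dpsi Z l) 0; [rewrite le_max lexx|rewrite /m; lra].
have e0 : 0 < m - dpsi Z l by rewrite subr_gt0.
have D0 : 0 < m^-1 - a^-1 by rewrite subr_gt0 ltf_pV2.
near=> x.
have [Bx] : 0 <= B x /\ `|x - dpsi Z l * B x| <= (m - dpsi Z l) * (1 + B x).
  by near: x; exact: class_L_dist.
rewrite ler_norml => /andP[_ H].
have H1 : x - (m - dpsi Z l) <= m * B x by lra.
have H2 : (x - (m - dpsi Z l)) / m <= B x by rewrite ler_pdivrMr// mulrC.
apply: le_trans H2.
have xc : (c + (m - dpsi Z l) / m) / (m^-1 - a^-1) <= x.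
  by near: x; apply: nbhs_pinfty_ge; exact: num_real.
rewrite ler_pdivrMr// in xc; lra.
Unshelve. all: by end_near. Qed.

Lemma class_L_le b : 0 < b -> b < dpsi Z l ->
  \forall x \near +oo, B x <= x / b + 1.
Proof.
(* The first bound on [e] absorbs [e * B x]; the second turns the constant into 1 after division by
   [b]. *)
move=> b0 bl; pose e := Num.min (dpsi Z l - b) b.
have e0 : 0 < e by rewrite lt_min subr_gt0 bl.
have eb : e <= b by rewrite ge_min lexx orbT.
have el : e <= dpsi Z l - b by rewrite ge_min lexx.
near=> x.
have [Bx] : 0 <= B x /\ `|x - dpsi Z l * B x| <= e * (1 + B x).
  by near: x; exact: class_L_dist.
rewrite ler_norml => /andP[H _].
have H1 := ler_wpM2r Bx el.
have H2 : b * B x <= x + b by lra.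
have : B x <= (x + b) / b by rewrite ler_pdivlMr// mulrC.
by rewrite mulrDl divff ?gt_eqF.
Unshelve. all: by end_near. Qed.

Lemma class_L_ge0 : \forall x \near +oo, 0 <= B x.
Proof. by case: HB. Qed.

End spatial_asymptotics.

Lemma cvg_expR_decay (R : realType) (c e : R) : 0 < e ->
  c * expR (- (e * x)) @[x --> +oo] --> (0 : R).
Proof.
move=> e0; rewrite -[X in _ --> X](mulr0 c); apply: cvgMl_tmp.
exact: cvg_comp (gt0_cvgMry e0 cvg_id) (@cvgr_expR R).
Qed.

(** The minimum exceeds [b] exactly when all the times do, and those events are independent. *)
Lemma probability_tau_min_le d (Omega : measurableType d) (R : realType)
    (Q : probability Omega R) (N : nat) (T : 'I_N -> {RV Q >-> \bar R})
    (p b : R) :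
  mutually_independent Q (fun i => T i : Omega -> \bar R) ->
  (forall i, Q (T i @^-1` [set y | (y <= b%:E)%E]) = p%:E) ->
  Q [set w | (tau_min (fun i => T i : Omega -> \bar R) w <= b%:E)%E] =
  (1 - (1 - p) ^+ N)%:E.
Proof.
move=> indep law.
pose late : set (\bar R) := [set y | (b%:E < y)%E].
pose early : set (\bar R) := [set y | (y <= b%:E)%E].
have mearly : measurable early.
  by rewrite -[X in measurable X]setTI; exact: emeasurable_fun_infty_c.
have mlate : measurable late.
  by rewrite -[X in measurable X]setTI; exact: emeasurable_fun_o_infty.
have lateE : late = ~` early.
  by apply/seteqP; split => y; rewrite /late /early /= ltNge => /negP.
have -> : [set w | (tau_min (fun i => T i : Omega -> \bar R) w <= b%:E)%E] =
    ~` [set w | forall i, late (T i w)].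
  apply/seteqP; split => w /=.
    move=> + H; apply/negP; rewrite -ltNge; apply/bigmin_gtP.
    by split=> [|i _]; [rewrite ltry|exact: H].
  apply: contra_notP => /negP; rewrite -ltNge => /bigmin_gtP[_ H] i; exact: H.
have mall : measurable [set w | forall i, late (T i w)].
  rewrite (_ : [set w | _] = \bigcap_(i in [set: 'I_N]) (T i @^-1` late)).
    apply: fin_bigcap_measurable => // i _; exact: measurable_funPTI.
  by apply/seteqP; split => w H i; [move=> _|]; exact: H.
rewrite probability_setC// (indep (fun=> late) (fun=> mlate)).
have Qlate i : Q (T i @^-1` late) = (1 - p)%:E.
  have mi : measurable (T i @^-1` early) by exact: measurable_funPTI.
  by rewrite lateE preimage_setC probability_setC// law EFinB.
under eq_bigr do rewrite Qlate.
by rewrite prodEFin big_const_ord iter_mulr_1 -EFinB.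
Qed.

(** Meant for the factorisation of [1 - (1 - p) ^+ N] as [p] times the sum of the [(1 - p) ^+ i], a
    sum that tends to [N] as [p] tends to 0. *)
Lemma cvg_sum_expr (R : realType) (T : Type) (F : set_system T) {FF : Filter F}
    (f : T -> R) (a : R) n :
  f x @[x --> F] --> a ->
  \sum_(i < n) f x ^+ i @[x --> F] --> \sum_(i < n) a ^+ i.
Proof.
move=> fa.
have fX k : f x ^+ k @[x --> F] --> a ^+ k.
  exact: (continuous_cvg _ (@exprn_continuous R k a) fa).
elim: n => [|n IH].
  by under eq_fun do rewrite big_ord0; rewrite big_ord0; exact: cvg_cst.
by under eq_fun do rewrite big_ord_recr; rewrite big_ord_recr; exact: cvgD.
Qed.

(** * The limits [N] and 0 of the ratio *)

Section phase_transition.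
Context d (Omega : measurableType d) (R : realType) (P : probability Omega R).
Variables (Z : R -> {RV P >-> R}) (mu sigma : R) (Pi : {measure set R -> \bar R}).
Hypotheses (HZ : levy_process Z) (Hsigma : 0 < sigma).
Hypothesis HLK : levy_khintchine Z mu sigma Pi.
Hypothesis Hdiff : forall l : R, Lambda_plus Z l ->
  derivable (rphi Z) l 1 /\ derivable (rphi Z)^`()%classic l 1.
Variable lstar : R.
Hypotheses (Hlstar : Lambda_plus Z lstar) (Hpsi : psi Z lstar = 0%E).
Hypothesis Htau : forall x : R, measurable_fun [set: Omega] (tau Z x).
Variables (l : R) (B : R -> R) (N : nat).
Hypotheses (Hl : Lambda_plus Z l) (HB : class_L Z l B) (HN : (2 <= N)%N).
Implicit Types x T : R.

Definition tau_cdf x T : R := fine (P [set w | (tau Z x w <= T%:E)%E]).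

Lemma tau_cdf_ge0 x T : 0 <= tau_cdf x T.
Proof. exact: fine_ge0. Qed.

Lemma tau_cdf_le1 x T : tau_cdf x T <= 1.
Proof.
have mT := measurable_tau_le Htau x T.
by rewrite -lee_fin fineK ?fin_num_measure//; exact: probability_le1.
Qed.

Lemma tau_cdf_le x T1 T2 : T1 <= T2 -> tau_cdf x T1 <= tau_cdf x T2.
Proof.
move=> T12; have [m1 m2] := (measurable_tau_le Htau x T1, measurable_tau_le Htau x T2).
rewrite -lee_fin !fineK ?fin_num_measure//; apply: le_measure; rewrite ?inE//.
by move=> w /= /le_trans; apply; rewrite lee_fin.
Qed.

Let N0 : 0 < N%:R :> R.
Proof. by rewrite ltr0n (leq_trans _ HN). Qed.

Lemma split_time_le x : 0 <= B x -> B x / N%:R <= B x.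
Proof. by move=> B0; rewrite ler_pdivrMr// ler_peMr// ler1n (leq_trans _ HN). Qed.

Lemma split_cdf_ratio_cvg :
  N%:R * dpsi Z l < dpsi Z lstar ->
  (1 - (1 - tau_cdf x (B x / N%:R)) ^+ N) / tau_cdf x (B x) @[x --> +oo] -->
  (N%:R : R).
Proof.
set L := dpsi Z l; set D := dpsi Z lstar => LD.
have D0 : 0 < D := dpsi_lstar_gt0 Hsigma HLK Hdiff Hlstar Hpsi.
have ls0 : 0 < lstar by case: Hlstar.
(* A speed strictly between [N L] and [D]: eventually [B x / N] exceeds [x / a1], which is later
   than the typical time [x / D]. *)
pose a1 := (Num.max (N%:R * L) 0 + D) / 2.
have [a10 a1D La1] : [/\ 0 < a1, a1 < D & N%:R * L < a1].
  have H1 : Num.max (N%:R * L) 0 < D by rewrite gt_max LD.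
  have H2 : 0 <= Num.max (N%:R * L) 0 by rewrite le_max lexx orbT.
  have H3 : N%:R * L <= Num.max (N%:R * L) 0 by rewrite le_max lexx.
  by split; rewrite /a1; lra.
have [h [h0 [Lh hpsi]]] : exists h, 0 < h /\
    (Lambda_plus Z (lstar - h) /\ rpsi Z (lstar - h) < rpsi Z lstar - h * a1).
  have [r /= r0 Hr] := Lambda_plus_near Hlstar.
  apply: (@filter_ex _ (0^'+ : set_system R)); near=> h.
  have h0 : 0 < h by near: h; exact: nbhs_right_gt.
  split=> //; split.
    by apply: Hr => /=; rewrite opprB addrC subrK gtr0_norm.
  by near: h; exact: near_left_lt_tangent (derivable_rpsi Hdiff Hlstar) a1D.
rewrite (rpsi_lstar Hpsi) sub0r in hpsi.
set t := lstar - h in Lh hpsi.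
have t0 : 0 < t by case: Lh.
have psit : rpsi Z t <= 0.
  by apply/ltW/(lt_trans hpsi); rewrite oppr_lt0 mulr_gt0.
(* The decay rate that [tau_prob_between] gives for [q - p] at parameter [t]; it beats [lstar] since
   [rpsi Z t < - h a1]. *)
pose k := t - rpsi Z t / a1.
have lk : lstar < k.
  have : rpsi Z t / a1 < - h by rewrite ltr_pdivrMr// mulNr.
  by rewrite /k /t; lra.
pose e := (k - lstar) / 2.
have e0 : 0 < e by rewrite divr_gt0// subr_gt0.
(* The first bound makes passage at speed [D - s] early enough for [B x / N]. The second solves
   [lstar (D + s) <= (lstar + e) (D - s)], so that [p] decays at rate at most [lstar + e], which is
   [k - e]. *)
pose s := Num.min (D - a1) (e * D / (2 * lstar + e)).
have s0 : 0 < s.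
  rewrite lt_min subr_gt0 a1D/=; apply: divr_gt0; first exact: mulr_gt0.
  by apply: addr_gt0 => //; exact: mulr_gt0.
have sa : a1 <= D - s by rewrite lerBrDr -lerBrDl ge_min lexx.
have sb : lstar * (D + s) <= (lstar + e) * (D - s).
  have : s <= e * D / (2 * lstar + e) by rewrite ge_min lexx orbT.
  by rewrite ler_pdivlMr ?addr_gt0 ?mulr_gt0//; lra.
have a0 : 0 < D - s by exact: lt_le_trans sa.
have Dab : D - s < D < D + s by rewrite ltrBlDr ltrDl s0.
pose c0 := expR (- (lstar * (D + s))) / 2.
have c00 : 0 < c0 by rewrite divr_gt0 ?expR_gt0.
have psi0 : 0 <= rpsi Z lstar by rewrite (rpsi_lstar Hpsi).
have lower := tau_prob_ge HZ Htau Hlstar (derivable_rpsi Hdiff Hlstar) psi0 a0 Dab.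
have La1N : L < a1 / N%:R by rewrite ltr_pdivlMr// mulrC.
have Bge := class_L_ge HB N%:R (divr_gt0 a10 N0) La1N.
pose p x := tau_cdf x (B x / N%:R); pose q x := tau_cdf x (B x).
pose C := expR (t - rpsi Z t).
have near_bounds : \forall x \near +oo, 0 < p x /\ (p x <= q x /\
    (q x <= expR lstar * expR (- (lstar * x)) /\
     1 - C / c0 * expR (- (e * x)) <= p x / q x)).
  near=> x.
  have x0 : 0 <= x by near: x; apply: nbhs_pinfty_ge; exact: num_real.
  have B0 : 0 <= B x by near: x; exact: class_L_ge0 HB.
  have BN : x / a1 + 1 <= B x / N%:R.
    rewrite ler_pdivlMr// mulrDl mul1r.
    have : x / (a1 / N%:R) + N%:R <= B x by near: x.
    by rewrite invf_div mulrA mulrAC.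
  have xa : x / (D - s) <= x / a1 by rewrite ler_wpM2l// lef_pV2.
  have p_lower : c0 * expR (- ((lstar + e) * x)) <= p x.
    apply: le_trans (tau_cdf_le x (le_trans _ BN) : tau_cdf x (x / (D - s) + 1) <= _).
      apply: le_trans _ (_ : c0 * expR (- ((lstar * (D + s) - rpsi Z lstar) / (D - s) * x)) <= _).
        rewrite ler_pM2l// ler_expR lerN2 ler_wpM2r// (rpsi_lstar Hpsi) subr0.
        by rewrite ler_pdivrMr.
      by near: x.
    by rewrite lerD2r.
  have p0 : 0 < p x by apply: lt_le_trans p_lower; rewrite mulr_gt0 ?expR_gt0.
  have pq : p x <= q x by apply: tau_cdf_le; exact: split_time_le.
  split=> //; split=> //; split.
    have := tau_prob_le HZ Htau x ls0 (Lambda_plus_sub Hlstar) psi0 B0.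
    by rewrite (rpsi_lstar Hpsi) addr0 mul0r sub0r.
  have q0 : 0 < q x by exact: lt_le_trans pq.
  have BN0 : 0 <= B x / N%:R by rewrite divr_ge0// ltW.
  have qp : q x - p x <= C * expR (- (k * x)).
    apply: le_trans (tau_prob_between HZ Htau x t0 (Lambda_plus_sub Lh) psit BN0
      (split_time_le B0)) _.
    rewrite ler_pM2l ?expR_gt0// ler_expR.
    have BN' : x / a1 <= B x / N%:R by rewrite (le_trans _ BN)// lerDl.
    have kx : k * x = t * x - rpsi Z t * (x / a1) by rewrite /k; ring.
    by rewrite kx opprB lerD2r; exact: ler_wnM2l.
  have qp' : q x - p x <= C / c0 * expR (- (e * x)) * p x.
    apply: le_trans qp _.
    have -> : expR (- (k * x)) = expR (- (e * x)) * expR (- ((lstar + e) * x)).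
      by rewrite -expRD; congr expR; rewrite /e; field.
    have -> : C * (expR (- (e * x)) * expR (- ((lstar + e) * x))) =
        C / c0 * expR (- (e * x)) * (c0 * expR (- ((lstar + e) * x))).
      by field; rewrite gt_eqF.
    by rewrite ler_wpM2l// mulr_ge0 ?expR_ge0// divr_ge0 ?expR_ge0// ltW.
  rewrite ler_pdivlMr// mulrBl mul1r lerBlDr -lerBlDl (le_trans qp')//.
  by rewrite ler_wpM2l// mulr_ge0 ?expR_ge0// divr_ge0 ?expR_ge0// ltW.
have pc : p x @[x --> +oo] --> (0 : R).
  apply: squeeze_cvgr (cvg_cst 0) (cvg_expR_decay (expR lstar) ls0).
  near=> x; rewrite tau_cdf_ge0/=.
  suff : 0 < p x /\ (p x <= q x /\ (q x <= expR lstar * expR (- (lstar * x)) /\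
     1 - C / c0 * expR (- (e * x)) <= p x / q x)).
    by move=> [_ [pq [qe _]]]; exact: le_trans pq qe.
  by near: x.
have pqc : p x / q x @[x --> +oo] --> (1 : R).
  apply: (@squeeze_cvgr _ _ _ _ (fun x => 1 - C / c0 * expR (- (e * x))) (cst 1)).
  - near=> x.
    suff : 0 < p x /\ (p x <= q x /\ (q x <= expR lstar * expR (- (lstar * x)) /\
     1 - C / c0 * expR (- (e * x)) <= p x / q x)).
      move=> [p0 [pq [_ ->]]]/=; rewrite ler_pdivrMr ?mul1r//; exact: lt_le_trans pq.
    by near: x.
  - rewrite -[X in _ --> X]subr0; apply: cvgB; first exact: cvg_cst.
    exact: cvg_expR_decay.
  - exact: cvg_cst.
have sumc : \sum_(i < N) (1 - p x) ^+ i @[x --> +oo] --> (N%:R : R).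
  have -> : N%:R = \sum_(i < N) (1 - 0) ^+ i :> R.
    under eq_bigr do rewrite subr0 expr1n.
    by rewrite sumr_const card_ord.
  by apply: cvg_sum_expr; apply: cvgB => //; exact: cvg_cst.
have -> : (fun x => (1 - (1 - tau_cdf x (B x / N%:R)) ^+ N) / tau_cdf x (B x)) =
    (fun x => p x / q x * \sum_(i < N) (1 - p x) ^+ i).
  apply/funext => x; rewrite -/(p x) -/(q x) mulrAC; congr (_ / _).
  rewrite -opprB subrX1; ring.
rewrite -[X in _ --> X]mul1r; exact: cvgM.
Unshelve. all: by end_near. Qed.

(** The union bound: in the geometric factorisation each of the [N] terms is at most 1. *)
Lemma split_cdf_ratio_le x : 0 <= B x ->
  0 <= (1 - (1 - tau_cdf x (B x / N%:R)) ^+ N) / tau_cdf x (B x) <=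
  N%:R * (tau_cdf x (B x / N%:R) / tau_cdf x (B x)).
Proof.
move=> B0; set p := tau_cdf x (B x / N%:R); set q := tau_cdf x (B x).
have p0 : 0 <= p := tau_cdf_ge0 _ _.
have p1 : 0 <= 1 - p by rewrite subr_ge0 tau_cdf_le1.
have q0 : 0 <= q^-1 by rewrite invr_ge0 tau_cdf_ge0.
have pE : 1 - (1 - p) ^+ N = p * \sum_(i < N) (1 - p) ^+ i.
  by rewrite -opprB subrX1; ring.
rewrite pE mulr_ge0//=; last by rewrite mulr_ge0// sumr_ge0// => i _; rewrite exprn_ge0.
rewrite mulrA ler_wpM2r// [N%:R * _]mulrC ler_wpM2l//.
rewrite -[X in _ <= X%:R]card_ord -sumr_const; apply: ler_sum => i _.
by rewrite exprn_ile1// gerBl.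
Qed.

Lemma split_cdf_ratio_cvg0 :
  N%:R * dpsi Z l > dpsi Z lstar ->
  (1 - (1 - tau_cdf x (B x / N%:R)) ^+ N) / tau_cdf x (B x) @[x --> +oo] -->
  (0 : R).
Proof.
have N1 : 1 < N%:R :> R by rewrite ltr1n.
set L := dpsi Z l; set D := dpsi Z lstar => LD.
have D0 : 0 < D := dpsi_lstar_gt0 Hsigma HLK Hdiff Hlstar Hpsi.
have ls0 : 0 < lstar by case: Hlstar.
have L0 : 0 < L by rewrite -(pmulr_rgt0 _ N0) (lt_trans D0).
have dpsi_le u v : Lambda_plus Z u -> Lambda_plus Z v -> u <= v ->
    dpsi Z u <= dpsi Z v.
  move=> Lu Lv; rewrite le_eqVlt => /predU1P[->|uv]; first exact: lexx.
  exact: ltW (dpsi_lt Hsigma HLK Hdiff Lu Lv uv).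
pose m := Num.max l lstar.
have Lm : Lambda_plus Z m by rewrite /m; case: leP.
have lm : l <= m by rewrite le_max lexx.
have lsm : lstar <= m by rewrite le_max lexx orbT.
set M := dpsi Z m.
have LM : L <= M by exact: dpsi_le.
have M0 : 0 < M by exact: lt_le_trans LM.
(* The limiting rate in the lower bound for [q]: [l - rpsi Z l / L] if [l > lstar], and [lstar]
   otherwise. *)
pose r := m - rpsi Z m / M.
(* [t - rpsi Z t / b] will be the decay rate of [p], as [B x / N] is at most about [x / b]. If
   [l > lstar], take [t = l] and [b] between [L] and [N L], gaining from [rpsi Z l > 0]. Otherwise
   take [b] between [D] and [N L], and [t] slightly above [lstar], where
   [rpsi Z t < (t - lstar) b]. *)
have [t [b [Lt [psit [b0 [bL rk]]]]]] : exists t b : R, Lambda_plus Z t /\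
    (0 <= rpsi Z t /\ (0 < b /\ (b < N%:R * L /\ r < t - rpsi Z t / b))).
  have [ll|ll] := ltP lstar l.
    have mE : m = l by rewrite /m max_l// ltW.
    have psi0 := rpsi_gt0 Hsigma HLK Hdiff Hlstar Hpsi Hl ll.
    exists l, ((L + N%:R * L) / 2).
    have NL : L < N%:R * L by rewrite (ltr_pMl _ L0); exact: N1.
    have bL : L < (L + N%:R * L) / 2 by lra.
    split=> //; split; first exact: ltW.
    split; first exact: lt_trans L0 bL.
    split; first by lra.
    rewrite /r /M mE ltrD2l ltrN2 (ltr_pM2l psi0) ltf_pV2; first exact: bL.
      by rewrite posrE; exact: lt_trans L0 bL.
    by rewrite posrE; exact: L0.
  have mE : m = lstar by rewrite /m max_r.
  pose b := (D + N%:R * L) / 2.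
  have bD : D < b by rewrite /b; lra.
  have b0 : 0 < b := lt_trans D0 bD.
  have [h [h0 [Lh hpsi]]] : exists h, 0 < h /\
      (Lambda_plus Z (lstar + h) /\ rpsi Z (lstar + h) < rpsi Z lstar + h * b).
    have [rr /= r0 Hr] := Lambda_plus_near Hlstar.
    apply: (@filter_ex _ (0^'+ : set_system R)); near=> h.
    have h0 : 0 < h by near: h; exact: nbhs_right_gt.
    split=> //; split.
      by apply: Hr => /=; rewrite opprD addrA subrr sub0r normrN gtr0_norm.
    by near: h; exact: near_right_lt_tangent (derivable_rpsi Hdiff Hlstar) bD.
  exists (lstar + h), b; split=> //; split.
    apply/ltW/(rpsi_gt0 Hsigma HLK Hdiff Hlstar Hpsi Lh).
    by rewrite ltrDl.
  split=> //; split; first by rewrite /b; lra.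
  rewrite /r mE (rpsi_lstar Hpsi) mul0r subr0.
  have : rpsi Z (lstar + h) / b < h.
    by rewrite ltr_pdivrMr//; move: hpsi; rewrite (rpsi_lstar Hpsi) add0r.
  lra.
set k := t - rpsi Z t / b in rk.
have t0 : 0 < t by case: Lt.
(* The tilt [s] lies strictly above [m], so that the midpoint of [M] and [dpsi Z s] exceeds [L] and
   is an admissible speed for both [tau_prob_ge] and [class_L_ge]. As [s] decreases to [m], the
   resulting rate for [q] tends to [r < k] by continuity of [rpsi] and [dpsi]. *)
have [s [ms [Ls Hs]]] : exists s, m < s /\ (Lambda_plus Z s /\
    (s * (dpsi Z s + (s - m)) - rpsi Z s) / ((M + dpsi Z s) / 2) < k).
  have cr : {for m, continuous (rpsi Z)} := continuous_rpsi Hdiff Lm.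
  have cd : {for m, continuous (dpsi Z)} := continuous_dpsi Hdiff Lm.
  have cvgE : (s * (dpsi Z s + (s - m)) - rpsi Z s) / ((M + dpsi Z s) / 2)
      @[s --> m] --> (m * (M + (m - m)) - rpsi Z m) / ((M + M) / 2).
    apply: cvgM.
      apply: cvgB; last exact: cr.
      apply: cvgM; first exact: cvg_id.
      apply: cvgD; first exact: cd.
      by apply: cvgB; [exact: cvg_id|exact: cvg_cst].
    apply: cvgV; first by rewrite gt_eqF//; lra.
    apply: cvgM; last exact: cvg_cst.
    by apply: cvgD; [exact: cvg_cst|exact: cd].
  have rE : (m * (M + (m - m)) - rpsi Z m) / ((M + M) / 2) = r.
    have -> : (M + M) / 2 = M by lra.
    by rewrite subrr addr0 mulrBl mulfK ?gt_eqF.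
  rewrite rE in cvgE.
  have near1 := cvgr_lt _ (cvg_at_right_filter cvgE) _ rk.
  have near2 : \forall s \near m^'+, Lambda_plus Z s.
    exact: cvg_at_right_filter cvg_id _ (Lambda_plus_near Lm).
  apply: (@filter_ex _ (m^'+ : set_system R)); near=> s.
  split; first by near: s; exact: nbhs_right_gt.
  by split; near: s; [exact: near2|exact: near1].
set a := (M + dpsi Z s) / 2 in Hs.
set c := dpsi Z s + (s - m) in Hs.
set rho := (s * c - rpsi Z s) / a in Hs.
have Ms : M < dpsi Z s := dpsi_lt Hsigma HLK Hdiff Lm Ls ms.
have a0 : 0 < a by rewrite /a; lra.
have asc : a < dpsi Z s < c.
  by apply/andP; split; [rewrite /a; lra|rewrite /c; lra].
have psis : 0 <= rpsi Z s.
  exact/ltW/(rpsi_gt0 Hsigma HLK Hdiff Hlstar Hpsi Ls)/(le_lt_trans lsm).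
have lower := tau_prob_ge HZ Htau Ls (derivable_rpsi Hdiff Ls) psis a0 asc.
have La : L < a by rewrite /a; lra.
have Bge := class_L_ge HB 1 a0 La.
have bNL : b / N%:R < L by rewrite ltr_pdivrMr// mulrC.
have Ble := class_L_le HB (divr_gt0 b0 N0) bNL.
pose C := expR (t + rpsi Z t) * expR (rpsi Z t).
pose c0 := expR (- (s * c)) / 2.
have c00 : 0 < c0 by rewrite divr_gt0 ?expR_gt0.
have C0 : 0 < C by rewrite mulr_gt0 ?expR_gt0.
have kr : 0 < k - rho by rewrite subr_gt0.
apply: (squeeze_cvgr _ (cvg_cst 0) (cvg_expR_decay (N%:R * (C / c0)) kr)).
near=> x.
have x0 : 0 <= x by near: x; apply: nbhs_pinfty_ge; exact: num_real.
have B0 : 0 <= B x by near: x; exact: class_L_ge0 HB.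
have /andP[-> /=] := split_cdf_ratio_le B0.
move=> /le_trans; apply; rewrite -mulrA ler_pM2l//.
have q_lower : c0 * expR (- (rho * x)) <= tau_cdf x (B x).
  have Bx : x / a + 1 <= B x by near: x.
  by apply: le_trans (tau_cdf_le x Bx); near: x.
have q0 : 0 < tau_cdf x (B x) by apply: lt_le_trans q_lower; rewrite mulr_gt0 ?expR_gt0.
have p_upper : tau_cdf x (B x / N%:R) <= C * expR (- (k * x)).
  have Bx : B x / N%:R <= x / b + 1.
    rewrite ler_pdivrMr// mulrDl mul1r.
    have : B x <= x / (b / N%:R) + 1 by near: x.
    rewrite invf_div mulrA mulrAC => /le_trans; apply.
    by rewrite lerD2l ler1n (leq_trans _ HN).
  have xb0 : 0 <= x / b + 1 by rewrite addr_ge0// divr_ge0// ltW.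
  apply: le_trans (tau_cdf_le x Bx) _.
  apply: le_trans (tau_prob_le HZ Htau x t0 (Lambda_plus_sub Lt) psit xb0) _.
  rewrite -mulrA ler_pM2l ?expR_gt0// -expRD ler_expR le_eqVlt; apply/orP; left.
  by apply/eqP; rewrite /k; ring.
rewrite ler_pdivrMr//; apply: (le_trans p_upper).
have -> : C * expR (- (k * x)) =
    C / c0 * expR (- ((k - rho) * x)) * (c0 * expR (- (rho * x))).
  have -> : - (k * x) = - ((k - rho) * x) + - (rho * x) by ring.
  by rewrite expRD; field; rewrite gt_eqF.
by rewrite ler_wpM2l// mulr_ge0 ?expR_ge0// divr_ge0// ltW.
Unshelve. all: by end_near. Qed.

End phase_transition.

Theorem theorem2 (R : realType)
    (d : measure_display) (Omega : measurableType d) (P : probability Omega R)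
    (Z : R -> {RV P >-> R})
    (mu sigma : R) (Pi : {measure set R -> \bar R})
    (HZ : levy_process Z)
    (HPi : levy_measure Pi)
    (Hsigma : 0 < sigma)
    (HLK : levy_khintchine Z mu sigma Pi)
    (Hne : Lambda_plus Z !=set0)
    (Hdiff : forall l : R, Lambda_plus Z l ->
      derivable (rphi Z) l 1 /\ derivable (rphi Z)^`()%classic l 1)
    (lstar : R) (Hlstar : Lambda_plus Z lstar) (Hpsi : psi Z lstar = 0%E)
    (Htau : forall x : R, measurable_fun [set: Omega] (tau Z x))
    (l : R) (Hl : Lambda_plus Z l)
    (B : R -> R) (HB : class_L Z l B)
    (N : nat) (HN : (2 <= N)%N)
    (d' : measure_display) (Omega' : measurableType d')
    (Q : probability Omega' R)
    (taus : R -> 'I_N -> {RV Q >-> \bar R})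
    (Hind : forall x : R, mutually_independent Q (taus x))
    (Hlaw : forall (x : R) (i : 'I_N) (A : set (\bar R)), measurable A ->
      Q (taus x i @^-1` A) = P (tau Z x @^-1` A)) :
  let ratio (x : R) : R :=
    fine (Q [set w | (tau_min (taus x) w <= (B x / N%:R)%:E)%E]) /
    fine (P [set w | (tau Z x w <= (B x)%:E)%E]) in
  (N%:R * dpsi Z l < dpsi Z lstar -> ratio x @[x --> +oo] --> (N%:R : R)) /\
  (N%:R * dpsi Z l > dpsi Z lstar -> ratio x @[x --> +oo] --> (0 : R)).
Proof.
move=> ratio.
have ratioE x : ratio x =
    (1 - (1 - tau_cdf Z x (B x / N%:R)) ^+ N) / tau_cdf Z x (B x).
  rewrite /ratio -/(tau_cdf Z x (B x)).
  rewrite (@probability_tau_min_le _ _ _ Q N (taus x)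
    (tau_cdf Z x (B x / N%:R)) (B x / N%:R) (Hind x))// => i.
  rewrite Hlaw; last first.
    by rewrite -[X in measurable X]setTI; exact: emeasurable_fun_infty_c.
  by rewrite fineK//; apply: fin_num_measure; exact: measurable_tau_le.
have -> : ratio = fun x =>
    (1 - (1 - tau_cdf Z x (B x / N%:R)) ^+ N) / tau_cdf Z x (B x).
  by apply/funext => x; exact: ratioE.
split=> Hcmp.
- exact: (split_cdf_ratio_cvg HZ Hsigma HLK Hdiff Hlstar Hpsi Htau HB HN Hcmp).
- exact: (split_cdf_ratio_cvg0 HZ Hsigma HLK Hdiff Hlstar Hpsi Htau Hl HB HN Hcmp).
Qed.
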